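(* Let $G$ be a simple $k$-regular one-factorable graph on an ordered vertex set, and let $\mathcal M(G)$ be its set of perfect matchings. Then $$\sum_{M\in\mathcal M(G)}\varepsilon(M)\,S(G-M)=k\,S(G).$$ In particular, if $n\ge4$ is even and $I$ is any perfect matching of $K_n$, then $$S(K_n-I)=\varepsilon(I)\frac{(n-1)S_n}{(n-1)!!}=\varepsilon(I)\frac{S_n}{(n-3)!!}.$$ Consequently, $(n-3)!!$ divides $S_n$, and $$S_n\ne0\quad\Longrightarrow\quad\chi'_{\mathrm P}(K_n-I)=\chi'_{\ell}(K_n-I)=n-2.$$ The quantities $\varepsilon$, $S(\cdot)$, $S_n$, $\chi'_\ell$, $\chi'_{\mathrm P}$ are as defined in the context.
   Context: Signs. For a perfect matching $M$ of a graph on a finite linearly ordered vertex set, let $\operatorname{cr}(M)$ be the number of unordered pairs of edges $\{a,c\},\{b,d\}\in M$ with $a<b<c<d$, and put $\varepsilon(M)=(-1)^{\operatorname{cr}(M)}$. A one-factorization of a graph is a partition of its edge set into perfect matchings (an unordered collection); a graph is one-factorable if it has one. For a one-factorization $\mathcal F$ put $\varepsilon(\mathcal F)=\prod_{M\in\mathcal F}\varepsilon(M)$. For a regular graph $G$ on an ordered vertex set, $S(G)=\sum_{\mathcal F}\varepsilon(\mathcal F)$, the sum over all one-factorizations of $G$ (with $S(G)=0$ if none exist; an edgeless graph has exactly the empty one-factorization, of sign $1$). For $n$ even, $K_n$ has ordered vertex set $0<1<\dots<n-1$ and $S_n=S(K_n)$. $G-M$ denotes $G$ with the edges of $M$ removed,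 on the same ordered vertex set. For odd $j$, $j!!=1\cdot3\cdots j$. Coloring indices of a graph $G$. $\chi'_\ell(G)$ is the least integer $k$ such that whenever each edge is assigned a list of $k$ colors, the edges can be properly colored from their lists. The edge-paintability index $\chi'_{\mathrm P}(G)$ is the least $k$ for which Painter has a winning strategy in the following game: each edge starts with $k$ tokens; in each round Lister marks a nonempty set of uncolored edges and removes one token from each of them; Painter then colors a matching consisting of marked edges (these edges are then colored permanently). After Painter's move, Lister wins if some uncolored edge has no token left. Painter wins if every edge is eventually colored. *)

(* Defs.v *)
From HB Require Import structures.
From mathcomp Require Import all_boot all_order all_algebra.

Set Implicit Arguments.
Unset Strict Implicit.
Unset Printing Implicit Defensive.

Import Order.TTheory GRing.Theory Num.Theory.
Local Open Scope ring_scope.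

(* A graph on V is given by its edge set, an edge being a two-element set of  *)
(* vertices; G - M is then the set difference E :\: M.                        *)
Definition simple_graph (V : finType) (E : {set {set V}}) : Prop :=
  forall e, e \in E -> #|e| = 2.

Definition regular_graph (V : finType) (E : {set {set V}}) (k : nat) : Prop :=
  forall v : V, #|[set e in E | v \in e]| = k.

Definition complete_graph (V : finType) : {set {set V}} := [set e : {set V} | #|e| == 2].

Definition perfect_matchings (V : finType) (E : {set {set V}}) :
    {set {set {set V}}} :=
  [set M : {set {set V}} | (M \subset E) && partition M [set: V]].

(* The blocks of a partition are nonempty, so the edgeless graph has exactly  *)
(* the empty one-factorization.                                               *)
Definition one_factorizations (V : finType) (E : {set {set V}}) :
    {set {set {set {set V}}}} :=
  [set F : {set {set {set V}}} |
    partition F E && (F \subset perfect_matchings E)].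

Definition one_factorable (V : finType) (E : {set {set V}}) : Prop :=
  exists F, F \in one_factorizations E.

Definition crossing_pair (d : Order.disp_t) (V : finOrderType d)
    (P : {set {set V}}) : bool :=
  [exists a : V, exists b : V, exists c : V, exists e : V,
    [&& (a < b)%O, (b < c)%O, (c < e)%O
      & P == [set [set a; c]; [set b; e]]]].

Definition cr (d : Order.disp_t) (V : finOrderType d) (M : {set {set V}}) :
    nat :=
  #|[set P : {set {set V}} | (P \subset M) && crossing_pair P]|.

Definition matching_sign (d : Order.disp_t) (V : finOrderType d)
    (M : {set {set V}}) : int :=
  (-1) ^+ cr M.

Definition factorization_sign (d : Order.disp_t) (V : finOrderType d)
    (F : {set {set {set V}}}) : int :=
  \prod_(M in F) matching_sign M.

Definition signed_count (d : Order.disp_t) (V : finOrderType d)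
    (E : {set {set V}}) : int :=
  \sum_(F in one_factorizations E) factorization_sign F.

Definition signed_count_complete (n : nat) : int :=
  signed_count (complete_graph 'I_n).

(* The double factorial j!! = 1 * 3 * ... * j, for odd j only.                *)
Definition odd_double_fact (j : nat) : nat :=
  (\prod_(1 <= i < j.+1 | odd i) i)%N.

Definition is_least (P : nat -> Prop) (k : nat) : Prop :=
  P k /\ forall j, P j -> (k <= j)%N.

Definition proper_edge_coloring (V : finType) (E : {set {set V}})
    (c : {set V} -> nat) : Prop :=
  forall e f, e \in E -> f \in E -> e != f -> ~~ [disjoint e & f] ->
    c e != c f.

(* Colors are natural numbers: finitely many finite lists only ever involve   *)
(* finitely many colors.                                                      *)
Definition edge_choosable (V : finType) (E : {set {set V}}) (k : nat) : Prop :=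
  forall L : {set V} -> seq nat,
    (forall e, e \in E -> uniq (L e) /\ size (L e) = k) ->
    exists c : {set V} -> nat,
      (forall e, e \in E -> c e \in L e) /\ proper_edge_coloring E c.

Definition is_list_chromatic_index (V : finType) (E : {set {set V}})
    (k : nat) : Prop :=
  is_least (edge_choosable E) k.

(* painter_wins U t: Painter, with Lister to move, has a winning strategy     *)
(* from the position where U is the set of uncolored edges and t e is the     *)
(* number of tokens left on e. A derivation is a (necessarily well-founded)   *)
(* strategy tree: X is Lister's marked set and M is the matching Painter      *)
(* answers with. That no uncolored edge is out of tokens is required in       *)
(* every position, including the initial one, so that 0 tokens never suffice  *)
(* when there is an edge.                                                     *)
Inductive painter_wins (V : finType) :
    {set {set V}} -> ({set V} -> nat) -> Prop :=
| PainterDone (t : {set V} -> nat) : painter_wins set0 t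
| PainterRound (U : {set {set V}}) (t : {set V} -> nat) :
    (forall e, e \in U -> (0 < t e)%N) ->
    (forall X : {set {set V}}, X != set0 -> X \subset U ->
      exists M : {set {set V}},
        [/\ M \subset X, trivIset M
          & painter_wins (U :\: M) (fun e => (t e - (e \in X))%N)]) ->
    painter_wins U t.

Definition is_paintability_index (V : finType) (E : {set {set V}})
    (k : nat) : Prop :=
  is_least (fun j => painter_wins E (fun=> j)) k.

(* Main.v *)
Require Import Defs.
From HB Require Import structures.
From mathcomp Require Import all_boot all_order all_algebra.
From mathcomp Require Import fingroup perm algC cyclotomic.

Set Implicit Arguments.
Unset Strict Implicit.
Unset Printing Implicit Defensive.

Import Order.TTheory GRing.Theory Num.Theory.
Local Open Scope ring_scope.

(** The signed counts satisfy S(E - M) e(M) = sum of e(F) over the factorizations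
    F containing M, so the first identity counts the k matchings of each F.

    For an ordered factorization (M_1, ..., M_k), the product of the signs of the
    M_i is, up to a constant depending on the graph only, the parity of the
    triples (v, i < j) with p_i v < p_j v, where p_i v is the mate of v in M_i.
    For K_n this parity does not change under a permutation of the vertices,
    because each inverted pair {a, b} is counted by the n - 2 other vertices v.
    Hence e(I) S(K_n - I) is the same for all (n - 1)!! perfect matchings I.

    The same parity is the sign of the product of X_va - X_vb (v a vertex, a < b
    neighbours of v) at a proper k-coloring of the edges, so evaluation at k-th
    roots of unity shows that the coefficient of the product of all X_e ^ (k - 1)
    is a nonzero multiple of S(G). A nonzero coefficient lets Painter win (the
    paintability version of the Alon-Tarsi theorem): on the edges marked by
    Lister, write "exponent >= d" as 1 - sum_(i < d) "exponent = i" and expand;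
    some term is nonzero, and Painter colors the edges on which it has 1. *)

(** * Linear functionals on products of differences *)

Section DifferenceProducts.

Variables (T : finType) (R : comNzRingType).
Implicit Types (m d : {ffun T -> nat}) (G : {ffun T -> nat} -> R).
Implicit Types (s : seq (T * T)) (p : T * T) (A W Y : {set T}).

Definition incr_at m e : {ffun T -> nat} := [ffun x => (m x + (x == e))%N].

(* The value at the polynomial \prod_((e, f) <- s) (X_e - X_f) of the linear  *)
(* functional that maps the monomial of exponent m to G m.                    *)
Fixpoint diffval s G : R :=
  if s is p :: s' then
    diffval s' (fun m => G (incr_at m p.1)) -
    diffval s' (fun m => G (incr_at m p.2))
  else G [ffun=> 0%N].

Definition pairs_within A : pred (T * T) :=
  fun p => (p.1 \in A) && (p.2 \in A).

(** Each factor raises one exponent inside [A] by one, so [diffval] reads its functional only at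
    exponents supported in [A] and of total degree [size s]. *)
Lemma eq_diffval A s G1 G2 :
    all (pairs_within A) s ->
    (forall m, (forall x, x \notin A -> m x = 0%N) ->
       (\sum_(x in A) m x)%N = size s -> G1 m = G2 m) ->
  diffval s G1 = diffval s G2.
Proof.
elim: s G1 G2 => [|[e f] s IHs] G1 G2 /=.
  move=> _; apply=> [x _|]; first by rewrite ffunE.
  by rewrite big1 // => x _; rewrite ffunE.
case/andP=> /andP[/= eA fA] sA eqG.
have sum_incr m g : g \in A ->
    (\sum_(x in A) incr_at m g x = (\sum_(x in A) m x).+1)%N.
  move=> gA; under eq_bigr do rewrite ffunE.
  rewrite big_split /= -addn1; congr (_ + _)%N.
  rewrite (bigD1 g) //= eqxx big1 ?addn0 // => x /andP[_ /negPf-> //].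
have incr_out m g x : g \in A -> x \notin A -> m x = 0%N -> incr_at m g x = 0%N.
  move=> gA xA mx; rewrite ffunE mx; case: eqP xA => // ->; by rewrite gA.
congr (_ - _); apply: IHs => // m m0 sm; apply: eqG => [x xA|].
- by apply: incr_out => //; apply: m0.
- by rewrite sum_incr // sm.
- by apply: incr_out => //; apply: m0.
- by rewrite sum_incr // sm.
Qed.

Lemma eq_diffval_ext s G1 G2 : G1 =1 G2 -> diffval s G1 = diffval s G2.
Proof.
move=> eqG; apply: (@eq_diffval setT) => //; apply/allP=> x _.
by rewrite /pairs_within !inE.
Qed.

Lemma diffval0 s : diffval s (fun=> 0) = 0.
Proof. by elim: s => //= p s ->; rewrite subrr. Qed.

Lemma diffvalB s G1 G2 :
  diffval s (fun m => G1 m - G2 m) = diffval s G1 - diffval s G2.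
Proof.
elim: s G1 G2 => //= p s IHs G1 G2.
by rewrite !IHs opprD opprK addrACA opprD opprK.
Qed.

Lemma diffvalZ s a G : diffval s (fun m => a * G m) = a * diffval s G.
Proof. by elim: s G => //= p s IHs G; rewrite !IHs mulrBr. Qed.

Lemma diffval_sum s (I : Type) (r : seq I) (P : pred I) (H : I -> {ffun T -> nat} -> R) :
  diffval s (fun m => \sum_(i <- r | P i) H i m) =
  \sum_(i <- r | P i) diffval s (H i).
Proof.
by elim: s H => //= p s IHs H; rewrite !IHs sumrB.
Qed.

(** This functional is evaluation at the point [z], hence multiplicative. *)
Lemma diffval_eval s A (z : T -> R) :
    all (pairs_within A) s ->
  diffval s (fun m => \prod_(x in A) z x ^+ m x) =
  \prod_(p <- s) (z p.1 - z p.2).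
Proof.
elim: s => [|[e f] s IHs] /=.
  by move=> _; rewrite big_nil big1 // => x _; rewrite ffunE.
case/andP=> /andP[/= eA fA] sA; rewrite big_cons -IHs // mulrBl -!diffvalZ.
have incrE m g : g \in A ->
    \prod_(x in A) z x ^+ incr_at m g x = z g * \prod_(x in A) z x ^+ m x.
  move=> gA; under eq_bigr do rewrite ffunE exprD.
  rewrite big_split /= mulrC; congr (_ * _).
  rewrite (bigD1 g) //= eqxx big1 ?mulr1 // => x /andP[_ /negPf-> //].
by congr (_ - _); apply: eq_diffval_ext => m; rewrite incrE.
Qed.

Lemma incr_atC m e f : incr_at (incr_at m e) f = incr_at (incr_at m f) e.
Proof. by apply/ffunP=> x; rewrite !ffunE addnAC. Qed.

(** Increments commute, so a factor can be pulled to the front; [perm_diffval] then allows any order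
    of the factors. *)
Lemma diffval_move s1 p s2 G :
  diffval (s1 ++ p :: s2) G = diffval (p :: s1 ++ s2) G.
Proof.
elim: s1 G => //= q s1 IHs G; rewrite !IHs /=.
have swap e f : diffval (s1 ++ s2) (fun m => G (incr_at (incr_at m e) f)) =
    diffval (s1 ++ s2) (fun m => G (incr_at (incr_at m f) e)).
  by apply: eq_diffval_ext => m; rewrite incr_atC.
rewrite (swap q.1 p.1) (swap q.1 p.2) (swap q.2 p.1) (swap q.2 p.2).
by rewrite !opprD !opprK addrACA.
Qed.

Lemma perm_diffval s1 s2 G : perm_eq s1 s2 -> diffval s1 G = diffval s2 G.
Proof.
elim: s1 s2 G => [|p s1 IHs] s2 G.
  by rewrite perm_sym => /perm_nilP->.
move=> eqs; have: p \in s2 by rewrite -(perm_mem eqs) mem_head.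
move=> ps2; case/splitPr: ps2 eqs => t1 t2 eqs.
rewrite diffval_move /=; have eqs' : perm_eq s1 (t1 ++ t2).
  by rewrite -(perm_cons p) (permPl eqs) perm_catC /= perm_cons perm_catC.
by rewrite !(IHs _ _ eqs').
Qed.

End DifferenceProducts.

(** * The algebra of one round of the game *)

Section PainterStep.

Variables (T : finType) (R : comNzRingType).
Implicit Types (d : T -> nat) (s : seq (T * T)) (W Y U X : {set T}).

Definition agree_on W d (m : {ffun T -> nat}) : bool :=
  [forall (x | x \in W), m x == d x].

Definition exceed_on Y d (m : {ffun T -> nat}) : bool :=
  [forall (x | x \in Y), d x <= m x]%N.

(* The coefficient of \prod_(x in W) X_x ^ d x, after setting X_x = 1 for     *)
(* every x outside W.                                                         *)
Definition diffcoef s W d : R := diffval s (fun m => (agree_on W d m)%:R).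

(** Induction on [Y]. At a chosen [y] the condition [d y <= m y] is expanded as 1 minus the sum of
    the conditions [m y = i] over [i < d y]. If the term 1 survives, [y] is released and stays
    outside [W']; otherwise some [i] survives, and [y] enters [W'] with the smaller exponent [i]. *)
Lemma diffval_truncate s W Y d :
    [disjoint W & Y] ->
    diffval s (fun m => (agree_on W d m && exceed_on Y d m)%:R) != 0 :> R ->
  exists W' d',
    [/\ W \subset W', W' \subset W :|: Y, forall x, x \in W -> d' x = d x,
        forall x, x \in W' :\: W -> (d' x < d x)%N
      & diffcoef s W' d' != 0].
Proof.
have [n] := ubnP #|Y|; elim: n => // n IHn in W Y d *;
  rewrite ltnS => leYn dWY nz.
have [Y0|[y yY]] := set_0Vmem Y.
  exists W, d; split=> //; first by rewrite subsetUl.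
    by move=> x; rewrite setDv inE.
  move: nz; rewrite /diffcoef Y0; congr (_ != 0); apply: eq_diffval_ext => m.
  suff -> : exceed_on set0 d m by rewrite andbT.
  by apply/forall_inP=> x; rewrite inE.
have yW : y \notin W by apply: contraL yY => yW; rewrite (disjointFr dWY).
set Y' := Y :\ y.
have ltY : (#|Y'| < n)%N by move: leYn; rewrite (cardsD1 y) yY.
pose dy i x := if x == y then i else d x.
have agreeU i m : agree_on (y |: W) (dy i) m = (m y == i) && agree_on W d m.
  apply/forall_inP/andP=> [h|[/eqP h1 /forall_inP h2] x].
    split; first by rewrite (eqP (h y _)) ?setU11 // /dy eqxx.
    apply/forall_inP=> x xW; rewrite (eqP (h x _)) ?inE ?xW ?orbT // /dy.
    by case: (eqVneq x y) xW => // ->; rewrite (negPf yW).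
  by rewrite !inE /dy; have [->|ne /= /h2] := eqVneq x y; first by rewrite h1.
have exceedD m : exceed_on Y d m = (d y <= m y)%N && exceed_on Y' d m.
  apply/forall_inP/andP=> [h|[h1 /forall_inP h2] x xY].
    by split; [apply: h|apply/forall_inP=> x /setD1P[_ /h]].
  by have [-> //|ne] := eqVneq x y; apply: h2; rewrite !inE ne.
have exceedY' i m : exceed_on Y' (dy i) m = exceed_on Y' d m.
  by apply: eq_forallb_in => x /setD1P[/negPf ne _]; rewrite /dy ne.
have [z1|nz1] :=
  eqVneq (diffval s (fun m => (agree_on W d m && exceed_on Y' d m)%:R)) (0 : R).
  have [/existsP[i nzi]|] := boolP [exists i : 'I_(d y), diffval s (fun m =>
      (agree_on (y |: W) (dy i) m && exceed_on Y' (dy i) m)%:R) != 0 :> R].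
    case: (IHn _ _ _ ltY _ nzi).
      rewrite disjoints_subset subUset sub1set !inE eqxx /=.
      by rewrite -disjoints_subset (disjointWr _ dWY) ?subsetDl.
    move=> W' [d' [WW' W'U d'W d'lt nz']].
    have yW' : y \in W' by apply: (subsetP WW'); rewrite setU11.
    exists W', d'; split=> //.
    - by apply: subset_trans WW'; rewrite subsetUr.
    - apply: (subset_trans W'U).
      by rewrite setUC setUA [Y' :|: _]setUC setD1K // setUC.
    - move=> x xW; rewrite d'W ?inE ?xW ?orbT // /dy.
      by case: (eqVneq x y) xW => // ->; rewrite (negPf yW).
    - move=> x; rewrite inE => /andP[xW xW'].
      have [->|ne] := eqVneq x y; first by rewrite d'W ?setU11 // /dy eqxx.
      have := d'lt x; rewrite !inE (negPf ne) (negPf xW) xW' => /(_ isT).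
      by rewrite /dy (negPf ne).
  rewrite negb_exists => /forallP zi; case/eqP: nz.
  have expand m : (agree_on W d m && exceed_on Y d m)%:R =
      (agree_on W d m && exceed_on Y' d m)%:R -
      \sum_(i < d y) (agree_on (y |: W) (dy i) m && exceed_on Y' (dy i) m)%:R :> R.
    rewrite exceedD; under eq_bigr do rewrite agreeU exceedY' -andbA.
    have [P|NP] := boolP (agree_on W d m && exceed_on Y' d m); last first.
      rewrite andbCA (negPf NP) andbF big1 ?subrr // => i _.
      by rewrite andbF.
    rewrite andbCA P andbT; have [le|lt] := leqP (d y) (m y).
      rewrite big1 ?subr0 // => i _.
      by rewrite gtn_eqF // (leq_trans (ltn_ord i) le).
    rewrite (bigD1 (Ordinal lt)) //= eqxx big1 ?addr0 ?subrr // => i.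
    by rewrite -val_eqE /= eq_sym => /negPf ->.
  rewrite (eq_diffval_ext _ expand) diffvalB z1 sub0r diffval_sum big1 ?oppr0 //.
  by move=> i _; apply/eqP; move: (zi i); rewrite negbK.
case: (IHn _ _ _ ltY _ nz1).
  by rewrite (disjointWr _ dWY) ?subsetDl.
move=> W' [d' [WW' W'U d'W d'lt nz']]; exists W', d'; split=> //.
by apply: (subset_trans W'U); rewrite setUS ?subsetDl.
Qed.

(** Variables outside [W] are set to 1. A factor with both ends outside [W] becomes [1 - 1 = 0], so
    none occurs. A factor with one end [g] in [W] becomes [X_g - 1] up to sign, and one of its two
    terms keeps a nonzero coefficient, with the exponent of [g] lowered by one or unchanged. *)
Lemma diffcoef_restrict s W d : diffcoef s W d != 0 ->
  all (fun p => (p.1 \in W) || (p.2 \in W)) s /\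
  exists2 d', (forall x, (d' x <= d x)%N)
    & diffcoef [seq p <- s | pairs_within W p] W d' != 0.
Proof.
set within := pairs_within W => nz.
(* The factors not inside [W] are moved to the front and removed one at a time. *)
suff main s1 s2 d1 : all (predC within) s1 -> diffcoef (s1 ++ s2) W d1 != 0 ->
    all (fun p => (p.1 \in W) || (p.2 \in W)) s1 /\
    exists2 d', (forall x, (d' x <= d1 x)%N) & diffcoef s2 W d' != 0.
  have perm : perm_eq s (filter (predC within) s ++ filter within s).
    by rewrite perm_sym perm_catC perm_filterC.
  move: nz; rewrite /diffcoef (perm_diffval _ perm) => nz.
  have [|ok [d' le nz']] := main _ _ _ _ nz; first by rewrite filter_all.
  split; last by exists d'.
  rewrite (perm_all _ perm) all_cat ok /=.
  by apply/allP=> p; rewrite mem_filter => /andP[/andP[-> _] _].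
elim: s1 d1 => [|[e f] s1 IHs] d1 /=; first by move=> _ nz1; split=> //;
  exists d1.
case/andP=> out outs; rewrite /diffcoef /=.
have agree_out g m : g \notin W -> agree_on W d1 (incr_at m g) = agree_on W d1 m.
  move=> gW; apply: eq_forallb_in => x xW; rewrite ffunE.
  by case: (eqVneq x g) xW => [->|]; rewrite ?(negPf gW) // addn0.
(* The truncated subtraction does no harm at [d1 g = 0]: there the conjunct [0 < d1 g] of [agree_in]
   is false. *)
pose dec g x := (d1 x - (x == g))%N.
have agree_in g m : g \in W -> agree_on W d1 (incr_at m g) =
    (0 < d1 g)%N && agree_on W (dec g) m.
  move=> gW; apply/forall_inP/andP=> [h|[h1 /forall_inP h2] x xW].
    split; first by have := h g gW; rewrite ffunE eqxx addn1 => /eqP<-.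
    by apply/forall_inP=> x xW; have := h x xW; rewrite ffunE /dec => /eqP<-;
      rewrite addnK.
  rewrite ffunE (eqP (h2 x xW)) /dec; case: (eqVneq x g) => [->|_];
    last by rewrite addn0 subn0.
  by rewrite subnK.
have keep g1 : g1 \notin W ->
    diffval (s1 ++ s2) (fun m => (agree_on W d1 (incr_at m g1))%:R) =
    diffcoef (s1 ++ s2) W d1.
  by move=> g1W; apply: eq_diffval_ext => m; rewrite agree_out.
have drop g1 : g1 \in W ->
    diffval (s1 ++ s2) (fun m => (agree_on W d1 (incr_at m g1))%:R) =
    (0 < d1 g1)%N%:R * diffcoef (s1 ++ s2) W (dec g1).
  move=> g1W; rewrite -diffvalZ; apply: eq_diffval_ext => m.
  by rewrite agree_in //; case: (0 < _)%N; rewrite ?mul1r ?mul0r.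
have step g1 b : diffcoef (s1 ++ s2) W d1 != 0 \/
      b%:R * diffcoef (s1 ++ s2) W (dec g1) != 0 ->
    all (fun p => (p.1 \in W) || (p.2 \in W)) s1 /\
    exists2 d', (forall x, (d' x <= d1 x)%N) & diffcoef s2 W d' != 0.
  case=> [/(IHs _ outs)[-> [d' le nz']]|]; first by split=> //; exists d'.
  have [->|nz1] := eqVneq (diffcoef (s1 ++ s2) W (dec g1)) 0.
    by rewrite mulr0 eqxx.
  move=> _; case: (IHs _ outs nz1) => -> [d' le nz']; split=> //;
    exists d' => // x.
  by apply: leq_trans (le x) _; rewrite leq_subr.
have subr_neq0 (a b : R) : a - b != 0 -> a != 0 \/ b != 0.
  have [->|a0 _] := eqVneq a 0; last by left.
  by rewrite sub0r oppr_eq0; right.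
have [eW|eW] := boolP (e \in W); have [fW|fW] := boolP (f \in W).
- by move: out; rewrite /within /pairs_within /= eW fW.
- by rewrite (drop e) // (keep f) //= => /subr_neq0[h|h];
  apply: (step e (0 < d1 e)%N); [right|left].
- by rewrite (keep e) // (drop f) //= => /subr_neq0[h|h];
  apply: (step f (0 < d1 f)%N); [left|right].
- by rewrite !keep // subrr eqxx.
Qed.

(** A homogeneous polynomial has only monomials of its own degree. *)
Lemma diffcoef_homogeneous s U d : all (pairs_within U) s ->
  diffcoef s U d != 0 -> (\sum_(x in U) d x)%N = size s.
Proof.
move=> sU; apply: contraNeq => ne; apply/eqP.
rewrite -(diffval0 R s); apply: (eq_diffval sU) => m _ sz.
have [/forall_inP h|//] := boolP (agree_on U d m).
case/negP: ne; rewrite -sz; apply/eqP; apply: eq_bigr => x xU.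
by rewrite (eqP (h x xU)).
Qed.

(** Painter colors the marked edges [M] that [diffval_truncate] releases. By [diffcoef_restrict] no
    pair of [s] taken inside [M] can occur, and the exponents do not grow on what remains. *)
Lemma diffcoef_round s U X d :
    X \subset U -> diffcoef [seq p <- s | pairs_within U p] U d != 0 ->
  exists (M : {set T}) d',
    [/\ M \subset X, {in s, forall p, ~~ pairs_within M p},
        forall x, x \in X :\: M -> (d' x < d x)%N,
        forall x, x \in U :\: M -> (d' x <= d x)%N
      & diffcoef [seq p <- s | pairs_within (U :\: M) p] (U :\: M) d' != 0].
Proof.
move=> XU nz; set sU := filter _ _ in nz.
have sUin : all (pairs_within U) sU by rewrite filter_all.
have sz := diffcoef_homogeneous sUin nz.
(* The total degree is fixed, so exponents at least [d] on [X] and equal to [d] on the rest of [U]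
   are equal to [d] throughout. The exact condition on [X] can thus be relaxed. *)
have nzX : diffval sU
    (fun m => (agree_on (U :\: X) d m && exceed_on X d m)%:R) != 0 :> R.
  move: nz; congr (_ != 0); apply: (eq_diffval sUin) => m _ szm.
  congr (_ : bool)%:R;
    apply/idP/andP=> [/forall_inP h|[/forall_inP h1 /forall_inP h2]].
    split; apply/forall_inP=> x; first by case/setDP=> xU _; apply: h.
    by move=> xX; rewrite (eqP (h x _)) // (subsetP XU).
  have le x : x \in U -> (d x <= m x ?= iff (d x == m x))%N.
    move=> xU; split=> //; have [/h2 //|xX] := boolP (x \in X).
    by rewrite (eqP (h1 x _)) // !inE xX.
  have := leqif_sum le; rewrite sz szm => -[_];
    rewrite eqxx => /esym/forall_inP h.
  by apply/forall_inP=> x /h; rewrite eq_sym.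
have dis : [disjoint U :\: X & X] by rewrite -setI_eq0 setIDAC -setIDA setDv setI0.
have [W [d1 [UW WU d1W d1lt nz1]]] := diffval_truncate dis nzX.
have {}WU : W \subset U by move: WU;
  rewrite setUC -[X in X :|: _](setIidPr XU) setID.
have UMW : U :\: (U :\: W) = W by rewrite setDDr setDv set0U (setIidPr WU).
have [allW [d' le nz']] := diffcoef_restrict nz1.
have lt1 x : x \in W -> x \in X -> (d1 x < d x)%N.
  by move=> xW xX; apply: d1lt; rewrite !inE xW xX.
exists (U :\: W), d'; rewrite UMW; split=> //.
- apply/subsetP=> x /setDP[xU]; apply: contraNT => xX.
  by apply: (subsetP UW); rewrite !inE xX.
- move=> p ps; apply/negP=> /andP[/setDP[p1U p1W] /setDP[p2U p2W]].
  have := allP allW p; rewrite mem_filter /pairs_within p1U p2U ps => /(_ isT).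
  by rewrite (negPf p1W) (negPf p2W).
- move=> x; rewrite !inE negb_and negbK => /andP[/orP[xW|xU] xX].
    exact: leq_ltn_trans (le x) (lt1 x xW xX).
  by rewrite (subsetP XU) in xU.
- move=> x xW; apply: leq_trans (le x) _; have [xX|xX] := boolP (x \in X).
    exact/ltnW/lt1.
  by rewrite d1W // !inE xX (subsetP WU).
- move: nz'; congr (diffcoef _ _ _ != 0); rewrite -filter_predI.
  apply: eq_in_filter => p _; rewrite /= /pairs_within.
  by case: (boolP (p.1 \in W)) => //= /(subsetP WU)->;
    case: (boolP (p.2 \in W)) => //= /(subsetP WU)->.
Qed.

End PainterStep.

(** * Winning strategies and list colorings *)

Section Painter.

Variable V : finType.
Implicit Types (E U X M : {set {set V}}) (t d : {set V} -> nat).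

(** The termination measure of the game: marked edges lose a token each, and at least one edge is
    marked. *)
Lemma sum_tokens_lt U X M t :
    (forall e, e \in U -> (0 < t e)%N) -> X != set0 -> X \subset U ->
  (\sum_(e in U :\: M) (t e - (e \in X)) < \sum_(e in U) t e)%N.
Proof.
move=> tpos /set0Pn[e eX] /subsetP XU.
apply: (@leq_ltn_trans (\sum_(e in U) (t e - (e \in X)))%N).
  rewrite [X in (_ <= X)%N](bigID (mem (U :\: M))) /=.
  apply: leq_trans (leq_addr _ _); apply: eq_leq; apply: eq_bigl => x.
  by rewrite inE andbC andbA andbb.
rewrite (bigD1 e) ?XU //= [X in (_ < X)%N](bigD1 e) ?XU //= eX -addSn.
apply: leq_add; first by rewrite subn1 prednK // tpos ?XU.
by apply: leq_sum => f _; rewrite leq_subr.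
Qed.

(** Invariant of the strategy: a nonzero coefficient, and [d e < t e] on every uncolored edge. A
    marked edge that stays uncolored loses a token, but its exponent drops too. [M] is a matching
    because any two adjacent edges of [U] form a pair of [s]. *)
Lemma painter_wins_diffcoef (R : comNzRingType) (s : seq ({set V} * {set V})) U t d :
    (forall e f, e \in U -> f \in U -> e != f -> ~~ [disjoint e & f] ->
       ((e, f) \in s) || ((f, e) \in s)) ->
    (forall e, e \in U -> (d e < t e)%N) ->
    diffcoef R [seq p <- s | pairs_within U p] U d != 0 ->
  painter_wins U t.
Proof.
have [n] := ubnP (\sum_(e in U) t e)%N; elim: n => // n IHn in U t d *.
rewrite ltnS => sum_t adj dt nz.
have tpos e : e \in U -> (0 < t e)%N by move=> eU;
  apply: leq_ltn_trans (dt e eU).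
apply: PainterRound => // X X0 XU.
have [M [d' [MX indep d'X d'U nz']]] := diffcoef_round XU nz.
have MU := subset_trans MX XU.
exists M; split=> //.
  apply/trivIsetP=> e f eM fM ef; apply: contraT => ndis.
  have [/indep|/indep] := orP (adj e f (subsetP MU _ eM) (subsetP MU _ fM) ef ndis);
    by rewrite /pairs_within /= eM fM.
apply: (IHn _ _ d') => //.
- exact: leq_trans (sum_tokens_lt _ tpos X0 XU) sum_t.
- by move=> e f /setDP[eU _] /setDP[fU _]; apply: adj.
- move=> e eUM; have /setDP[eU eM] := eUM.
  have [eX|eX] := boolP (e \in X); last first.
    by rewrite subn0; apply: leq_ltn_trans (d'U e eUM) (dt e eU).
  rewrite subn1 -ltnS prednK ?tpos //; apply: leq_ltn_trans (dt e eU).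
  by apply: d'X; rewrite !inE eM eX.
Qed.

(** The lists play Lister: for a color [x], the edges whose list still contains [x] are marked.
    Painter's matching receives [x], which is then removed from all lists, so that tokens keep
    counting the remaining colors. *)
Lemma painter_wins_list_coloring U t (L : {set V} -> seq nat) :
    painter_wins U t ->
    (forall e, e \in U -> uniq (L e) /\ size (L e) = t e) ->
  exists c : {set V} -> nat,
    (forall e, e \in U -> c e \in L e) /\ proper_edge_coloring U c.
Proof.
have [n] := ubnP (\sum_(e in U) t e)%N; elim: n => // n IHn in U t L *.
rewrite ltnS => sum_t win;
  case: win sum_t => [t0 _ _|U0 t0 tpos strat sum_t UL].
  by exists (fun=> 0%N); split=> [e|e f]; rewrite inE.
have [->|/set0Pn[e0 e0U]] := eqVneq U0 set0.
  by exists (fun=> 0%N); split=> [e|e f]; rewrite inE.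
(* Taking [x] from the list of an uncolored edge makes the marked set nonempty. *)
have [x xL] : exists x, x \in L e0.
  have [_] := UL e0 e0U; have := tpos e0 e0U.
  by case: (L e0) => [|x l] /= lt0 sz; [rewrite -sz in lt0|exists x;
    rewrite mem_head].
pose X := [set e in U0 | x \in L e].
have XU : X \subset U0 by apply/subsetP=> e; rewrite inE => /andP[].
have X0 : X != set0 by apply/set0Pn; exists e0; rewrite inE e0U.
have [M [MX trivM win]] := strat X X0 XU.
pose L' e := rem x (L e).
have [|e /setDP[eU eM]|c [cL' cP]] := IHn _ _ L' _ win.
- exact: leq_trans (sum_tokens_lt _ tpos X0 XU) sum_t.
- have [uL sL] := UL e eU; rewrite rem_uniq //; split=> //.
  rewrite /X inE eU /=; have [xLe|xLe] := boolP (x \in L e).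
    by rewrite size_rem // sL subn1.
  by rewrite /L' rem_id // sL subn0.
have c_neq e : e \in U0 -> e \notin M -> (c e \in L e) && (c e != x).
  move=> eU eM; have := cL' e; rewrite !inE eU eM => /(_ isT).
  by rewrite /L' (rem_filter _ (UL e eU).1) mem_filter andbC.
exists (fun e => if e \in M then x else c e); split=> [e eU|e f eU fU ef ndis].
  case: ifPn => [/(subsetP MX)|eM]; first by rewrite inE => /andP[].
  by have /andP[] := c_neq e eU eM.
have [eM|eM] := boolP (e \in M); have [fM|fM] := boolP (f \in M).
- by move/trivIsetP: trivM => /(_ e f eM fM ef); rewrite (negPf ndis).
- by rewrite eq_sym; have /andP[] := c_neq f fU fM.
- by have /andP[] := c_neq e eU eM.
- by apply: cP => //; rewrite !inE ?eM ?fM.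
Qed.

Lemma painter_wins_choosable E k :
  painter_wins E (fun=> k) -> edge_choosable E k.
Proof. by move=> win L EL; apply: (painter_wins_list_coloring win). Qed.

(** With all lists equal to [iota 0 k], the edges at [v] need distinct colors out of [k]. *)
Lemma choosable_degree E k v :
  edge_choosable E k -> (#|[set e in E | v \in e]| <= k)%N.
Proof.
move=> /(_ (fun=> iota 0 k))[e _|c [cL cP]].
  by rewrite iota_uniq size_iota.
set S := [set e in E | v \in e].
have inj : {in S &, injective c}.
  move=> e f; rewrite !inE => /andP[eE ve] /andP[fE vf] cef.
  apply/eqP; apply: contraT => ef; move: (cP e f eE fE ef); rewrite cef eqxx.
  by apply; apply/pred0Pn; exists v; rewrite /= ve vf.
rewrite cardE -(size_map c) -[k in (_ <= k)%N](size_iota 0).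
apply: uniq_leq_size => [|_ /mapP[e eS ->]].
  by rewrite map_inj_in_uniq ?enum_uniq // => e f; rewrite !mem_enum;
    apply: inj.
by apply: cL; move: eS; rewrite mem_enum inE => /andP[].
Qed.

(** A winning number of tokens is choosable, and a choosable number is at least the degree of [v];
    this bounds both indices from below. *)
Lemma painter_wins_indices E k v :
    painter_wins E (fun=> k) -> #|[set e in E | v \in e]| = k ->
  is_paintability_index E k /\ is_list_chromatic_index E k.
Proof.
move=> win deg; have chk := painter_wins_choosable win.
split; split=> // j; rewrite -deg; last exact: choosable_degree.
by move/painter_wins_choosable; apply: choosable_degree.
Qed.

End Painter.

(** * Perfect matchings and mates *)

Section Matchings.

Variable V : finType.
Implicit Types (E M N : {set {set V}}) (e f : {set V}) (F : {set {set {set V}}}).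
Implicit Types u v w : V.

(** The boolean form lets it rewrite index conditions when a block is added to or removed from a
    partition. *)
Lemma partition_with_block (T : finType) (B D : {set T}) (P : {set {set T}}) :
    B != set0 -> B \subset D ->
  partition (B |: P) D && (B \notin P) = partition P (D :\: B).
Proof.
move=> B0 BD; apply/andP/idP=> [[partP BP]|partP].
  by rewrite -(setU1K BP) partitionD1 // setU11.
split; last first.
  have [x xB] := set0Pn _ B0; apply/negP=> /(partitionS partP)/subsetP/(_ x xB).
  by rewrite inE xB.
rewrite -(setID D B) (setIidPr BD) partitionU1 //.
by rewrite -setI_eq0 setIDA setIC -setIDA setDv setI0.
Qed.

Lemma mem_block M e v :
  partition M [set: V] -> (e \in M) && (v \in e) = (e == pblock M v).
Proof.
case/and3P=> /eqP covM trivM _; apply/andP/eqP=> [[eM ve]|->].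
  by rewrite (def_pblock trivM eM ve).
by rewrite pblock_mem ?mem_pblock covM ?inE.
Qed.

Lemma perfect_matchingP E M : reflect
  (M \subset E /\ partition M [set: V]) (M \in perfect_matchings E).
Proof. by rewrite inE; apply: andP. Qed.

Lemma big_matching (R : Type) (idx : R) (op : Monoid.com_law idx) M (H : V -> R) :
    partition M [set: V] ->
  \big[op/idx]_(e in M) \big[op/idx]_(v in e) H v = \big[op/idx]_v H v.
Proof.
move=> pM; rewrite -[LHS](set_partition_big (op := op) M pM).
by apply: eq_bigl => v; rewrite inE.
Qed.

(** Each matching of [F] has exactly one edge at [v], so the degree of [v] counts the matchings. *)
Lemma card_one_factorization E F k v :
  regular_graph E k -> F \in one_factorizations E -> #|F| = k.
Proof.
move=> reg; rewrite inE => /andP[/and3P[/eqP covF trivF _] /subsetP FM].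
have -> : k = (\sum_(e in E) (v \in e))%N.
  rewrite -(reg v) -sum1_card big_mkcond [RHS]big_mkcond /=.
  by apply: eq_bigr => e _; rewrite inE; case: (e \in E).
rewrite -covF big_trivIset // -sum1_card; apply: eq_bigr => M /FM.
case/perfect_matchingP=> _ partM.
by rewrite -big_mkcondr /= (big_pred1 (pblock M v)) // => e; rewrite mem_block.
Qed.

(** The default is not reached when [M] is a perfect matching of the complete graph, whose blocks
    have two elements. *)
Definition mate M v : V := odflt v [pick w in pblock M v :\ v].

Variable M : {set {set V}}.
Hypothesis pmM : M \in perfect_matchings (complete_graph V).

Let partM : partition M [set: V]. Proof. by case/perfect_matchingP: pmM. Qed.

Lemma card_edge e : e \in M -> #|e| = 2.
Proof. by case/perfect_matchingP: pmM => /subsetP MK _ /MK;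
  rewrite inE => /eqP. Qed.

Lemma pblock_mate v : pblock M v = [set v; mate M v] /\ mate M v != v.
Proof.
have /andP[bM vb] : (pblock M v \in M) && (v \in pblock M v) by rewrite mem_block.
have /cards1P[w bw] : #|pblock M v :\ v| == 1%N.
  by have := card_edge bM; rewrite (cardsD1 v) vb => /eqP.
rewrite /mate; case: pickP => [u|/(_ w)]; last by rewrite bw set11.
rewrite /= {1}bw => /set1P->; split; first by rewrite -{1}(setD1K vb) bw.
by have := set11 w; rewrite -bw => /setD1P[].
Qed.

Lemma mate_neq v : mate M v != v. Proof. by case: (pblock_mate v). Qed.

Lemma mate_edge v : [set v; mate M v] \in M.
Proof.
have [<- _] := pblock_mate v.
by have /andP[] : (pblock M v \in M) && (v \in pblock M v) by rewrite mem_block.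
Qed.

Lemma edge_mate e v : e \in M -> v \in e -> e = [set v; mate M v].
Proof.
move=> eM ve; have [<- _] := pblock_mate v.
by apply/eqP; rewrite -mem_block // eM.
Qed.

Lemma mate_unique v w : v != w -> [set v; w] \in M -> mate M v = w.
Proof.
move=> vw /edge_mate-/(_ v (set21 v w))/setP/(_ w).
by rewrite set22 !inE eq_sym (negPf vw) /= => /esym/eqP.
Qed.

Lemma mateK : involutive (mate M).
Proof.
by move=> v; apply: mate_unique (mate_neq v) _; rewrite setUC mate_edge.
Qed.

Lemma card_matching : (#|M| * 2 = #|V|)%N.
Proof.
rewrite -cardsT (card_uniform_partition _ partM (n := 2)) // => e.
exact: card_edge.
Qed.

End Matchings.

(** * Factorizations containing a given matching *)

Section FactorizationsWithMatching.

Variables (d : Order.disp_t) (V : finOrderType d).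
Implicit Types (E M : {set {set V}}) (F : {set {set {set V}}}).

(** Removing [M] is a bijection from the factorizations of [E] that contain [M] to those of
    [E :\: M], and it splits off the sign of [M]. *)
Lemma sum_factorizations_with E M : (0 < #|V|)%N -> M \in perfect_matchings E ->
  \sum_(F in one_factorizations E | M \in F) factorization_sign F =
  matching_sign M * signed_count (E :\: M).
Proof.
move=> V0 /perfect_matchingP[ME partM].
(* Blocks of a partition must be nonempty; [M] is, because [V] is. *)
have M0 : M != set0.
  apply: contraTneq V0 => M0; move: partM; rewrite M0 => /cover_partition.
  by rewrite /cover big_set0 -cardsT => <-; rewrite cards0.
rewrite (reindex_onto (fun F => M |: F) (fun F => F :\ M)) /=; last first.
  by move=> F /andP[_ MF]; rewrite setD1K.
have memP F : (M |: F \in one_factorizations E) && (M \in M |: F) && ((M |: F) :\ M == F)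
    = (F \in one_factorizations (E :\: M)).
  rewrite setU11 andbT !inE;
    apply/andP/andP=> [[/andP[partF FM] /eqP eqF]|[partF FM]].
    have MF : M \notin F by rewrite -eqF !inE eqxx.
    have partF' : partition F (E :\: M) by rewrite -partition_with_block // partF.
    split=> //; apply/subsetP=> N NF; rewrite inE (partitionS partF' NF) /=.
    by have /(subsetP FM) : N \in M |: F by [rewrite setU1r];
      rewrite inE => /andP[].
  move: partF; rewrite -partition_with_block // => /andP[-> MF].
  split; last by rewrite setU1K.
  rewrite subUset sub1set inE ME partM; apply/subsetP=> N /(subsetP FM).
  rewrite !inE => /andP[NE ->]; rewrite andbT; apply: subset_trans NE _.
  exact: subsetDl.
rewrite (eq_bigl _ _ memP) /signed_count big_distrr /=; apply: eq_bigr => F.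
rewrite inE => /andP[partF _]; rewrite /factorization_sign big_setU1 //.
by move: partF; rewrite -partition_with_block // => /andP[].
Qed.

Lemma sum_signed_count_deletion E k : (0 < #|V|)%N -> regular_graph E k ->
  \sum_(M in perfect_matchings E) matching_sign M * signed_count (E :\: M) =
  k%:R * signed_count E.
Proof.
move=> V0 reg; have /card_gt0P[v _] := V0.
under eq_bigr => M pmM do rewrite -sum_factorizations_with //.
rewrite (exchange_big_dep (mem (one_factorizations E))) /=;
  last by move=> M F _ /andP[].
rewrite /signed_count big_distrr /=; apply: eq_bigr => F FE.
rewrite -(card_one_factorization v reg FE) mulr_natl -sumr_const;
  apply: eq_bigl => M.
rewrite FE /=; have [MF|//] := boolP (M \in F); rewrite ?andbF // andbT.
by move: FE; rewrite inE => /andP[_ /subsetP->].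
Qed.

End FactorizationsWithMatching.

(** * Crossing signs *)

Section Crossings.

Variables (d : Order.disp_t) (V : finOrderType d).
Implicit Types (M N E : {set {set V}}) (e f : {set V}) (u v w x y : V).

Local Notation sgn b := ((-1) ^+ nat_of_bool b : int).

Lemma sgn_sqr b : sgn b * sgn b = 1.
Proof. by case: b. Qed.

(** Ordered form of [crossing_pair]: [e] is the edge with the smallest endpoint, so only one order
    of two crossing edges counts. *)
Definition crosses e f : bool :=
  [exists a : V, exists b : V, exists c : V, exists g : V,
    [&& (a < b)%O, (b < c)%O, (c < g)%O, e == [set a; c] & f == [set b; g]]].

Lemma crossesP e f :
  reflect (exists a b c g, [/\ (a < b)%O, (b < c)%O, (c < g)%O,
                               e = [set a; c] & f = [set b; g]])
          (crosses e f).
Proof.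
apply: (iffP existsP) => [[a /existsP[b /existsP[c /existsP[g]]]]|].
  by case/and5P=> ? ? ? /eqP ? /eqP ?; exists a, b, c, g.
case=> a [b [c [g [ab bc cg -> ->]]]]; exists a; apply/existsP; exists b.
by apply/existsP; exists c; apply/existsP; exists g; rewrite ab bc cg !eqxx.
Qed.

Lemma set2_lt_inj x y u v : (x < y)%O -> (u < v)%O ->
  [set x; y] = [set u; v] -> x = u /\ y = v.
Proof.
move=> xy uv eqS.
have := set21 x y; have := set22 x y; rewrite eqS !inE.
case/orP=> /eqP ey; case/orP=> /eqP ex //; subst.
- by rewrite ltxx in xy.
- by have := lt_trans xy uv; rewrite ltxx.
- by rewrite ltxx in xy.
Qed.

Lemma crosses_set2 x1 x2 y1 y2 : (x1 < x2)%O -> (y1 < y2)%O ->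
  crosses [set x1; x2] [set y1;
    y2] = [&& (x1 < y1)%O, (y1 < x2)%O & (x2 < y2)%O].
Proof.
move=> ltx lty; apply/crossesP/and3P=> [[a [b [c [g [ab bc cg]]]]]|[? ? ?]].
  by move=> /(set2_lt_inj ltx (lt_trans ab bc))[-> ->] /(set2_lt_inj lty (lt_trans bc cg))[-> ->].
by exists x1, y1, x2, y2.
Qed.

Lemma crosses_disjoint e f : crosses e f -> [disjoint e & f].
Proof.
case/crossesP=> a [b [c [g [ab bc cg -> ->]]]].
rewrite disjoints_subset; apply/subsetP=> x; rewrite !inE negb_or.
case/orP=> /eqP->.
  by rewrite !lt_eqF //; apply: lt_trans (lt_trans ab bc) cg.
by rewrite gt_eqF // lt_eqF.
Qed.

Lemma crosses_asym e f : crosses e f -> crosses f e = false.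
Proof.
case/crossesP=> a [b [c [g [ab bc cg -> ->]]]].
have ac := lt_trans ab bc; have bg := lt_trans bc cg.
by rewrite crosses_set2 // (lt_gtF ab).
Qed.

Lemma edge_lt e : #|e| = 2 -> exists x y, (x < y)%O /\ e = [set x; y].
Proof.
move/eqP/cards2P=> [x [y [xy ->]]]; have [lt|lt] := orP (lt_total xy).
  by exists x, y.
by exists y, x; rewrite setUC.
Qed.

(** Among the four pairs of endpoints, [x < y] holds 0 or 4 times for separated edges, 2 times for
    nested ones, and 1 or 3 times for crossing ones. *)
Lemma crosses_sgn e f : #|e| = 2 -> #|f| = 2 -> [disjoint e & f] ->
  sgn (crosses e f) * sgn (crosses f e) =
  \prod_(x in e) \prod_(y in f) sgn (x < y)%O.
Proof.
case/edge_lt=> x1 [x2 [ltx ->]] /edge_lt[y1 [y2 [lty ->]]] dis.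
rewrite !crosses_set2 //.
rewrite !(big_setU1, big_set1) ?inE ?(lt_eqF ltx) ?(lt_eqF lty) //=.
have ne x y : x \in [set x1; x2] -> y \in [set y1;
  y2] -> (y < x)%O = ~~ (x < y)%O.
  move=> xe yf; rewrite -leNgt le_eqVlt; case: eqP => // yx.
  by rewrite yx (disjointFr dis xe) in yf.
rewrite (ne x1 y1) ?(ne x2 y1) ?(ne x2 y2) ?set21 ?set22 //.
(* Transitivity rules out the truth values that no order of the four endpoints realizes. *)
have := fun h => lt_trans ltx (h : (x2 < y1)%O).
have := fun h => lt_trans ltx (h : (x2 < y2)%O).
have := fun h => lt_trans (h : (x1 < y1)%O) lty.
have := fun h => lt_trans (h : (x2 < y1)%O) lty.
rewrite -!signr_addb => H1 H2 H3 H4; congr ((-1) ^+ nat_of_bool _).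
by case: (x1 < y1)%O (x1 < y2)%O (x2 < y1)%O (x2 < y2)%O H1 H2 H3 H4 =>
  [] [] [] [] // H1 H2 H3 H4;
  first [by have := H1 isT | by have := H2 isT | by have := H3 isT | by have := H4 isT].
Qed.

(** Since [crosses] is asymmetric, an unordered crossing pair comes from exactly one ordered
    pair. *)
Lemma cr_sum M : cr M = (\sum_(e in M) \sum_(f in M) crosses e f)%N.
Proof.
pose A := [set p | [&& p.1 \in M, p.2 \in M & crosses p.1 p.2]].
transitivity #|A|; last first.
  rewrite pair_big_dep /= -sum1_card [RHS]big_mkcond [LHS]big_mkcond /=.
  by apply: eq_bigr => -[e f] _; rewrite inE /=; case: (e \in M);
    case: (f \in M); case: crosses.
rewrite /cr.
rewrite -(card_in_imset (f := fun p => [set p.1;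
  p.2]) (D := A)) => [|[e f] [e' f']].
  apply: eq_card => P; rewrite inE; apply/andP/imsetP.
    case=> PM /existsP[a /existsP[b /existsP[c /existsP[g]]]].
    case/and4P=> ab bc cg /eqP eqP; exists ([set a; c], [set b; g]) => //.
    move: PM; rewrite eqP subUset !sub1set /A !inE => /andP[-> ->] /=.
    by apply/crossesP; exists a, b, c, g.
  case=> -[e f]; rewrite /A inE /= => /and3P[eM fM /crossesP].
  case=> a [b [c [g [ab bc cg ee ff]]]] ->; rewrite subUset !sub1set eM fM;
    split=> //.
  apply/existsP; exists a; apply/existsP; exists b; apply/existsP; exists c.
  by apply/existsP; exists g; rewrite ab bc cg ee ff eqxx.
rewrite !inE /= => /and3P[_ _ ef] /and3P[_ _ ef'] eqS.
have ne h h' : crosses h h' -> h != h'.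
  by move=> hh; apply: contraTneq (hh) => eqh; have := crosses_asym hh;
    rewrite eqh => ->.
have := set21 e f; have := set22 e f; rewrite eqS !inE.
case/orP=> /eqP fE; case/orP=> /eqP eE.
- by have := ne _ _ ef; rewrite fE eE eqxx.
- by rewrite eE fE (crosses_asym ef') in ef.
- by rewrite eE fE.
- by have := ne _ _ ef; rewrite fE eE eqxx.
Qed.

(** On each edge exactly one endpoint is below its mate. *)
Lemma prod_sgn_mate M : M \in perfect_matchings (complete_graph V) ->
  \prod_v sgn (v < mate M v)%O = (-1) ^+ #|M|.
Proof.
move=> pmM; have [_ partM] := perfect_matchingP _ _ pmM.
rewrite -(big_matching _ _ partM) -prodr_const; apply: eq_bigr => e eM.
have [v ve] : exists v, v \in e.
  by apply/set0Pn; rewrite -card_gt0 (card_edge pmM).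
rewrite (edge_mate pmM eM ve) big_setU1 ?big_set1 ?inE 1?eq_sym ?mate_neq //=.
rewrite mateK //; have := lt_total (mate_neq pmM v).
by case/orP=> lt; rewrite lt (lt_gtF lt).
Qed.

(* Group the pairs (x, y) by the edge e of M at x and the edge f of N at y.   *)
(* If e and f are disjoint the group contributes their crossing sign; if they *)
(* meet at v it contributes the comparisons of v and of its two mates, and    *)
(* those that involve v itself cancel in the product over all v.              *)
Lemma crossing_parity M N :
    M \in perfect_matchings (complete_graph V) ->
    N \in perfect_matchings (complete_graph V) -> [disjoint M & N] ->
  (\prod_(e in M) \prod_(f in N) (sgn (crosses e f) * sgn (crosses f e))) *
    \prod_v sgn (mate M v < mate N v)%O =
  \prod_(x : V) \prod_(y : V) sgn (x < y)%O.
Proof.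
move=> pmM pmN dMN; have [_ partM] := perfect_matchingP _ _ pmM.
have [_ partN] := perfect_matchingP _ _ pmN.
pose chi (e f : {set V}) := \prod_(x in e) \prod_(y in f) sgn (x < y)%O.
pose kap v := chi [set v; mate M v] [set v; mate N v].
have chiE e f : e \in M -> f \in N -> chi e f =
    sgn (crosses e f) * sgn (crosses f e) * \prod_(v in e) (if v \in f then kap v else 1).
  move=> eM fN; rewrite -big_mkcondr /=.
  have [dis|/pred0Pn[v /andP[/= ve vf]]] := boolP [disjoint e & f].
    rewrite crosses_sgn ?(card_edge pmM eM) ?(card_edge pmN fN) //.
    rewrite [X in _ * X]big_pred0 ?mulr1 //.
    by move=> v; have [/(disjointFr dis)|] := boolP (v \in e).
  have crF e' f' : v \in e' -> v \in f' -> crosses e' f' = false.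
    by move=> ve' vf'; apply/negbTE/negP=> /crosses_disjoint dis;
      rewrite (disjointFr dis ve') in vf'.
  rewrite !crF // !mul1r (big_pred1 v).
    by rewrite /kap -(edge_mate pmM eM ve) -(edge_mate pmN fN vf).
  move=> w; apply/andP/eqP=> [[we wf]|->] //. apply/eqP; apply: contraT => wv.
  (* Edges with two common vertices would coincide, against the disjointness of [M] and [N]. *)
  have vw2 : #|[set v; w]| = 2 by rewrite cards2 eq_sym wv.
  have sub2 (h : {set V}) : #|h| = 2 -> v \in h -> w \in h -> h = [set v; w].
    move=> h2 vh wh; apply/eqP; rewrite eq_sym eqEcard vw2 h2 andbT.
    by rewrite subUset !sub1set vh.
  have ee := sub2 e (card_edge pmM eM) ve we;
    have ff := sub2 f (card_edge pmN fN) vf wf.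
  by rewrite -(disjointFr dMN eM) ee -ff fN.
have -> : \prod_(x : V) \prod_(y : V) sgn (x < y)%O = \prod_(e in M) \prod_(f in N) chi e f.
  rewrite -[LHS](big_matching _ _ partM); apply: eq_bigr => e _.
  rewrite [RHS]exchange_big /=; apply: eq_bigr => x _.
  by rewrite -[LHS](big_matching _ _ partN).
transitivity ((\prod_(e in M) \prod_(f in N) (sgn (crosses e f) * sgn (crosses f e))) *
    \prod_v kap v); last first.
  rewrite -[X in _ * X](big_matching _ _ partM) -big_split;
    apply: eq_bigr => e eM /=.
  rewrite [RHS](eq_bigr _ (fun f fN => chiE e f eM fN)) [RHS]big_split /=;
    congr (_ * _).
  rewrite [RHS]exchange_big /=; apply: eq_bigr => v _; rewrite -big_mkcondr /=.
  by rewrite (big_pred1 (pblock N v)) // => f; rewrite mem_block.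
congr (_ * _); rewrite /kap /chi.
under [RHS]eq_bigr => v _.
  rewrite big_setU1 ?inE 1?eq_sym ?mate_neq //= big_set1.
  rewrite !big_setU1 ?inE 1?eq_sym ?mate_neq //= !big_set1 ltxx mul1r.
  over.
rewrite !big_split /= mulrA prod_sgn_mate //.
(* Reindexing by [mate M] turns [mate M v < v] into [v < mate M v]; the two products that involve
   [v] are then powers of -1 with the equal exponents [#|N|] and [#|M|]. *)
rewrite [X in _ * X * _](reindex_inj (inv_inj (mateK pmM))) /=.
under [X in _ * X * _]eq_bigr do rewrite mateK //.
rewrite prod_sgn_mate // -exprD;
  suff -> : #|N| = #|M| by rewrite addnn -signr_odd odd_double mul1r.
by apply/eqP; rewrite -(eqn_pmul2r (isT : 0 < 2)%N) !card_matching.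
Qed.

End Crossings.

(** * Products over pairs of indices *)

Lemma big_split_diag (R : Type) (idx : R) (op : Monoid.com_law idx) k
    (A : 'I_k -> 'I_k -> R) :
  \big[op/idx]_i \big[op/idx]_j A i j =
  op (\big[op/idx]_i A i i)
     (\big[op/idx]_(i < k) \big[op/idx]_(j < k | (i < j)%N) op (A i j) (A j i)).
Proof.
rewrite [X in op _ X](eq_bigr _ (fun i _ => big_split _ _ _ _ _)) big_split /=.
rewrite [X in op _ (op _ X)](exchange_big_dep predT) //= -!big_split /=.
apply: eq_bigr => i _; rewrite (bigD1 i) //=; congr (op _ _).
rewrite (bigID (fun j : 'I_k => (i < j)%N)) /=; congr (op _ _);
  apply: eq_bigl => j.
  by rewrite -val_eqE neq_ltn; case: (ltngtP i j).
by rewrite -val_eqE neq_ltn; case: (ltngtP i j).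
Qed.

(** Both sides run once over the unordered pairs in [N], ordered on the left as points and on the
    right by their indices. *)
Lemma prod_ordered_pairs (R : comNzRingType) (d : Order.disp_t)
    (V : finOrderType d) k (p : 'I_k -> V) (N : {set V}) (H : V -> V -> R) :
    injective p -> N = [set p i | i : 'I_k] ->
    (forall a b, a != b -> H a b = H b a) ->
  \prod_(a in N) \prod_(b in N | (a < b)%O) H a b =
  \prod_(i < k) \prod_(j < k | (i < j)%N) H (p i) (p j).
Proof.
move=> inj -> symH; rewrite big_imset; last by move=> i j _ _; apply: inj.
transitivity (\prod_i \prod_(j | (p i < p j)%O) H (p i) (p j)).
  by apply: eq_bigr => i _; rewrite big_imset_cond //= => j1 j2 _ _; apply: inj.
(* [B] and [C] collect the index pairs on which [p] preserves and reverses the order. *)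
pose B (i j : 'I_k) := (i < j)%N && (p i < p j)%O.
pose C (i j : 'I_k) := (i < j)%N && (p j < p i)%O.
have neq i j : i != j -> p i != p j by rewrite (inj_eq inj).
transitivity (\prod_i \prod_(j | B i j) H (p i) (p j) *
    \prod_i \prod_(j | C j i) H (p i) (p j)).
  rewrite -big_split; apply: eq_bigr => i _ /=.
  rewrite (bigID (fun j : 'I_k => (i < j)%N)) /=; congr (_ * _);
    apply: eq_bigl => j.
    by rewrite andbC.
  rewrite /C andbC; case: (ltngtP i j) => // /val_inj ->; by rewrite ltxx.
rewrite [X in _ * X](exchange_big_dep predT) //= -big_split;
  apply: eq_bigr => i _ /=.
rewrite [RHS](bigID (fun j : 'I_k => (p i < p j)%O)) /=; congr (_ * _).
rewrite (eq_bigl (fun j : 'I_k => (i < j)%N && ~~ (p i < p j)%O)) => [|j].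
  apply: eq_bigr => j /andP[ij _]; apply: symH; apply: neq.
  by rewrite -val_eqE gtn_eqF.
rewrite /C; case: (ltnP i j) => //= ij; rewrite -leNgt le_eqVlt.
by rewrite (inj_eq inj) -val_eqE gtn_eqF.
Qed.

(** * Signs of ordered factorizations *)

Section OrderedFactorizations.

Variables (d : Order.disp_t) (V : finOrderType d) (k : nat).
Variable g : 'I_k -> {set {set V}}.
Hypothesis pm_g : forall i, g i \in perfect_matchings (complete_graph V).
Hypothesis dis_g : forall i j, i != j -> [disjoint g i & g j].

Local Notation sgn b := ((-1) ^+ nat_of_bool b : int).

Lemma mate_color_inj v : injective (fun i => mate (g i) v).
Proof.
move=> i j /= eq_mate; apply/eqP; apply: contraT => /dis_g dij.
have := mate_edge (pm_g i) v; rewrite eq_mate => vi.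
by have := disjointFr dij vi; rewrite mate_edge.
Qed.

Lemma mate_color_image v :
  [set w | w != v & [set v;
    w] \in \bigcup_i g i] = [set mate (g i) v | i : 'I_k].
Proof.
apply/setP=> w; rewrite inE;
  apply/andP/imsetP=> [[wv /bigcupP[i _ vw]]|[i _ ->]].
  by exists i; rewrite ?(mate_unique (pm_g i) _ vw) // eq_sym.
by rewrite mate_neq //; split=> //; apply/bigcupP; exists i; rewrite ?mate_edge.
Qed.

(** Crossings in the union lie within one [g i] or between two of them, and [crossing_parity]
    rewrites the latter. Only the comparisons of mates then depend on how the union is split into
    [k] matchings. *)
Lemma sign_ordered_factorization :
  \prod_i matching_sign (g i) =
  (-1) ^+ cr (\bigcup_i g i) *
  \prod_(i < k) \prod_(j < k | (i < j)%N)
    (\prod_(x : V) \prod_(y : V) sgn (x < y)%O *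
     \prod_v sgn (mate (g i) v < mate (g j) v)%O).
Proof.
rewrite cr_sum partition_disjoint_bigcup //.
have -> : (\sum_i \sum_(e in g i) \sum_(f in \bigcup_i g i) crosses e f =
    \sum_i \sum_j \sum_(e in g i) \sum_(f in g j) crosses e f)%N.
  apply: eq_bigr => i _; rewrite [RHS]exchange_big /=; apply: eq_bigr => e _.
  by rewrite partition_disjoint_bigcup.
rewrite big_split_diag /= exprD.
have -> : (-1) ^+ (\sum_(i < k) \sum_(e in g i) \sum_(f in g i) crosses e f) =
    \prod_i matching_sign (g i).
  rewrite expr_sum.
  by apply: eq_bigr => i _; rewrite /matching_sign cr_sum.
rewrite -mulrA -[LHS]mulr1; congr (_ * _).
rewrite expr_sum -big_split /= big1 // => i _.
rewrite expr_sum -big_split /= big1 // => j ij.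
have nij : i != j by rewrite -val_eqE ltn_eqF.
rewrite -(crossing_parity (pm_g i) (pm_g j) (dis_g nij)).
set Q := \prod_v _.
have QQ : Q * Q = 1 by rewrite -big_split big1 //= => v _; rewrite sgn_sqr.
rewrite -[_ * Q * Q]mulrA QQ mulr1.
have -> : (-1) ^+ (\sum_(e in g i) \sum_(f in g j) crosses e f +
    \sum_(e in g j) \sum_(f in g i) crosses e f) =
  \prod_(e in g i) \prod_(f in g j) (sgn (crosses e f) * sgn (crosses f e)).
  rewrite [X in (_ + X)%N]exchange_big -big_split /=.
  rewrite expr_sum; apply: eq_bigr => e _.
  rewrite -big_split /= expr_sum.
  by apply: eq_bigr => f _; rewrite exprD.
rewrite -big_split big1 //= => e _; rewrite -big_split big1 //= => f _.
by rewrite mulrACA !sgn_sqr mulr1.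
Qed.

End OrderedFactorizations.

(** * The action of vertex permutations *)

Section Relabelling.

Variable V : finType.
Implicit Types (M N : {set {set V}}) (F : {set {set {set V}}}) (s t : {perm V}).

Local Notation K := (complete_graph V).
Local Notation pm := (perfect_matchings K).

Definition relabel s M : {set {set V}} := [set s @: (e : {set V}) | e in M].

Lemma relabel_inj s : injective (relabel s).
Proof. exact: imset_inj (imset_inj perm_inj). Qed.

Lemma relabelM s t M : relabel (s * t)%g M = relabel t (relabel s M).
Proof.
rewrite /relabel -imset_comp; apply: eq_imset => e /=; rewrite -imset_comp.
by apply: eq_imset => x; rewrite /= permM.
Qed.

Lemma relabel1 M : relabel 1%g M = M.
Proof.
rewrite /relabel -[RHS]imset_id; apply: eq_imset => e; rewrite -[RHS]imset_id.
by apply: eq_imset => x; rewrite perm1.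
Qed.

Lemma mem_relabel s M (e : {set V}) : (s @: e \in relabel s M) = (e \in M).
Proof. by rewrite mem_imset //; apply: imset_inj perm_inj. Qed.

Lemma relabel_complete s : relabel s K = K.
Proof.
apply/eqP; rewrite eqEcard card_imset ?leqnn ?andbT;
  last exact: imset_inj perm_inj.
by apply/subsetP=> _ /imsetP[e eK ->]; move: eK; rewrite !inE card_imset //;
  apply: perm_inj.
Qed.

Lemma relabel_perfect s M : (relabel s M \in pm) = (M \in pm).
Proof.
rewrite !inE; congr (_ && _).
  apply/subsetP/subsetP=> sub e.
    by rewrite -(mem_relabel s) => /sub; rewrite !inE card_imset //;
      apply: perm_inj.
  by case/imsetP=> f /sub fK ->; rewrite -(relabel_complete s) mem_relabel.
rewrite -[RHS](imset_partition _ _ (@perm_inj _ s)).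
congr (partition _ _); apply/esym/setP=> x; rewrite inE.
by apply/imsetP; exists (s^-1%g x); rewrite ?inE ?permKV.
Qed.

Lemma relabel_factorization s F :
  (relabel s @: F \in one_factorizations K) = (F \in one_factorizations K).
Proof.
rewrite !inE -{1}(relabel_complete s).
rewrite (imset_partition _ _ (imset_inj (@perm_inj _ s))); congr (_ && _).
apply/subsetP/subsetP=> sub M.
  by move=> MF; rewrite -(relabel_perfect s) sub ?imset_f.
by case/imsetP=> N /sub NK ->; rewrite relabel_perfect.
Qed.

Lemma mate_relabel s M v : M \in pm -> mate (relabel s M) (s v) = s (mate M v).
Proof.
move=> pmM; apply: mate_unique; rewrite ?relabel_perfect //.
  by rewrite (inj_eq perm_inj) eq_sym mate_neq.
have -> : [set s v; s (mate M v)] = s @: [set v; mate M v].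
  by rewrite imsetU !imset_set1.
by rewrite mem_relabel mate_edge.
Qed.

(* A transposition can add any edge of N to M without losing an edge of M and *)
(* N in common.                                                               *)
Lemma relabel_transitive M N : M \in pm -> N \in pm -> exists s, relabel s M = N.
Proof.
have [n] := ubnP #|N :\: M|; elim: n => // n IHn in M *;
  rewrite ltnS => leNM pmM pmN.
have [NM0|[e]] := set_0Vmem (N :\: M).
  exists 1%g; rewrite relabel1; apply/esym/eqP.
  rewrite eqEcard -(leq_pmul2r (isT : 0 < 2)%N) !card_matching // leqnn andbT.
  by rewrite -setD_eq0 NM0.
case/setDP=> eN eM; have [a ae] : exists a, a \in e.
  by apply/set0Pn; rewrite -card_gt0 (card_edge pmN).
pose b := mate N a; pose a' := mate M a; have ee := edge_mate pmN eN ae.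
have neab : a' != b.
  by apply: contraNneq eM => eqab; rewrite ee -/b -eqab mate_edge.
(* Exchanging the two mates of [a] turns the edge [[set a; a']] of [M] into [e]. A common edge
   contains neither [a'], whose edge in [M] leads to [a], nor [b], whose edge in [N] is [e]. *)
pose s := tperm a' b.
have sa : s a = a by rewrite /s tpermD // mate_neq.
have fix_common h : h \in M -> h \in N -> s @: h = h.
  move=> hM hN; rewrite -[RHS]imset_id; apply: eq_in_imset => x xh; rewrite /s.
  have hM' := edge_mate pmM hM xh; have hN' := edge_mate pmN hN xh.
  rewrite tpermD //; apply: contraTneq hM => eqx; subst x.
    rewrite /a' mateK // setUC in hM'; apply: contra neab => _.
    by rewrite /b -(mate_unique pmN _ (_ : [set a;
      a'] \in N)) ?(eq_sym a) ?mate_neq // -hM'.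
  by rewrite hN' /b mateK // setUC -ee.
have es : e \in relabel s M.
  have -> : e = s @: [set a; a'] by rewrite imsetU !imset_set1 sa /s tpermL.
  by rewrite mem_relabel mate_edge.
have [||t eqN] := IHn (relabel s M) _ _ pmN; last by exists (s * t)%g;
  rewrite relabelM.
  apply: leq_trans leNM; apply: proper_card; apply/properP; split.
    apply/subsetP=> h; rewrite !inE => /andP[hs hN]; rewrite hN andbT.
    by apply: contra hs => hM; rewrite -(fix_common h hM hN) mem_relabel.
  by exists e; rewrite !inE ?eN ?eM ?es.
by rewrite relabel_perfect.
Qed.

End Relabelling.

(** * Invariance of signs for the complete graph *)

Section CompleteGraph.

Variables (d : Order.disp_t) (V : finOrderType d).
Hypothesis V_even : ~~ odd #|V|.
Implicit Types (M N : {set {set V}}) (F : {set {set {set V}}}) (s : {perm V}).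

Local Notation K := (complete_graph V).
Local Notation pm := (perfect_matchings K).
Local Notation sgn b := ((-1) ^+ nat_of_bool b : int).

Lemma prod_sign_relabel k (g : 'I_k -> {set {set V}}) s :
    (forall i, g i \in pm) -> (forall i j, i != j -> [disjoint g i & g j]) ->
    \bigcup_i g i = K ->
  \prod_i matching_sign (relabel s (g i)) = \prod_i matching_sign (g i).
Proof.
move=> pm_g dis_g covg.
have pm_sg i : relabel s (g i) \in pm by rewrite relabel_perfect.
have dis_sg i j : i != j -> [disjoint relabel s (g i) & relabel s (g j)].
  by move=> ij; rewrite imset_disjoint ?dis_g //; apply: imset_inj perm_inj.
have cov_sg : \bigcup_i relabel s (g i) = K.
  rewrite -(relabel_complete s) -covg; apply/setP=> e; apply/bigcupP/imsetP.
    by case=> i _ /imsetP[f fi ->]; exists f => //; apply/bigcupP; exists i.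
  by case=> f /bigcupP[i _ fi] ->; exists i => //; apply: imset_f.
rewrite !sign_ordered_factorization // covg cov_sg; congr (_ * _).
(* [r a b] is -1 exactly when [s] inverts the pair. *)
pose r a b := sgn (a < b)%O * sgn (s a < s b)%O.
have r_sym a b : a != b -> r a b = r b a.
  move=> ab;
    rewrite /r (lt_neqAle b a) (lt_neqAle (s b)) (inj_eq perm_inj) eq_sym ab /=.
  rewrite !leNgt; case: (a < b)%O; by case: (s a < s b)%O.
have r_sqr a b : r a b ^+ 2 = 1 by rewrite /r expr2 mulrACA !sgn_sqr mulr1.
transitivity (\prod_(i < k) \prod_(j < k | (i < j)%N)
    (\prod_(x : V) \prod_(y : V) sgn (x < y)%O *
     \prod_v sgn (mate (g i) v < mate (g j) v)%O) *
  \prod_v \prod_(i < k) \prod_(j < k | (i < j)%N) r (mate (g i) v) (mate (g j) v)).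
  rewrite [X in _ = _ * X]exchange_big -big_split; apply: eq_bigr => i _ /=.
  rewrite [X in _ = _ * X]exchange_big -big_split; apply: eq_bigr => j _ /=.
  rewrite -mulrA; congr (_ * _);
    rewrite (reindex_inj (@perm_inj _ s)) -big_split /=.
  by apply: eq_bigr => v _; rewrite !mate_relabel // /r mulrA sgn_sqr mul1r.
rewrite -[RHS]mulr1; congr (_ * _).
(* The mates of [v] are all the other vertices, so the pairs of colors at [v] become the pairs
   [a < b] that avoid [v]. *)
transitivity (\prod_v \prod_a \prod_b
    (if [&& a != v, b != v & (a < b)%O] then r a b else 1)).
  apply: eq_bigr => v _; rewrite -(prod_ordered_pairs (N := [set~ v])) //.
  - rewrite big_mkcond; apply: eq_bigr => a _; rewrite !inE.
    case: (a != v) => /=; last by rewrite big1.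
    by rewrite big_mkcond; apply: eq_bigr => b _; rewrite !inE.
  - exact: mate_color_inj.
  - rewrite -mate_color_image // covg; apply/setP=> w; rewrite !inE cards2.
    by rewrite [v == w]eq_sym; case: (w != v).
rewrite exchange_big big1 //= => a _; rewrite exchange_big big1 //= => b _.
have [ab|_] := boolP (a < b)%O; last by rewrite big1 // => v _; rewrite !andbF.
rewrite -big_mkcond /= prodr_const.
have -> : #|[pred v | [&& a != v, b != v & true]]| = #|~: [set a; b]|.
  by apply: eq_card => v; rewrite !inE andbT negb_or ![v == _]eq_sym.
have card2 : #|[set a; b]| = 2 by rewrite cards2 lt_eqF.
rewrite cardsCs setCK card2 -[(_ - _)%N]odd_double_half oddB.
  by rewrite (negPf V_even) -mul2n exprM r_sqr expr1n.
by rewrite -card2 max_card.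
Qed.

Lemma factorization_sign_relabel F s : F \in one_factorizations K ->
  factorization_sign (relabel s @: F) = factorization_sign F.
Proof.
move=> FK; have: F \in one_factorizations K by [].
rewrite inE => /andP[partF /subsetP FM].
rewrite /factorization_sign big_imset /=; last by move=> M N _ _;
  apply: relabel_inj.
rewrite [LHS]big_enum_val [RHS]big_enum_val prod_sign_relabel //.
- by move=> i; apply: FM; apply: enum_valP.
- move=> i j ij; have /trivIsetP := partition_trivIset partF; apply;
  rewrite ?enum_valP //.
  by rewrite (inj_eq enum_val_inj).
- by rewrite -(cover_partition partF) /cover [RHS]big_enum_val.
Qed.

(** A permutation carrying [M] to [N] maps the factorizations containing [M] onto those containing
    [N] and preserves their signs. *)
Lemma signed_count_deletion_eq M N : (0 < #|V|)%N -> M \in pm -> N \in pm ->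
  matching_sign M * signed_count (K :\: M) = matching_sign N * signed_count (K :\: N).
Proof.
move=> V0 pmM pmN; have [s <-] := relabel_transitive pmM pmN.
rewrite -!sum_factorizations_with ?relabel_perfect //.
rewrite [RHS](reindex_inj (imset_inj (@relabel_inj _ s))) /=.
apply: eq_big => [F|F /andP[FK _]]; last by rewrite factorization_sign_relabel.
by rewrite relabel_factorization mem_imset //; apply: relabel_inj.
Qed.

End CompleteGraph.

(** * The number of perfect matchings *)

Section CountMatchings.

Variable V : finType.
Implicit Types (A : {set V}) (M : {set {set V}}).

Definition pairings A : {set {set {set V}}} :=
  [set M : {set {set V}} | (M \subset complete_graph V) && partition M A].

(** For [m = 0] the truncated [m.*2 - 1] is 0, and the empty product gives the value 1 of (-1)!!. *)
Lemma odd_double_factS m : odd_double_fact m.*2.+1 = (odd_double_fact (m.*2 - 1) * m.*2.+1)%N.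
Proof.
rewrite /odd_double_fact big_mkcond big_nat_recr //= odd_double /=;
  congr (_ * _)%N.
rewrite -big_mkcond; case: m => [|m]; first by rewrite !big_geq.
by rewrite doubleS subn1 /= [LHS]big_mkcond big_nat_recr //= odd_double /= muln1 -big_mkcond.
Qed.

(** A fixed [a] has one partner [b] among the other points of [A], and the remaining edges pair up
    [A] without [a] and [b]. *)
Lemma card_pairings m A : #|A| = m.*2 -> #|pairings A| = odd_double_fact (m.*2 - 1).
Proof.
elim: m A => [|m IHm] A cardA.
  rewrite [RHS]big_geq //; apply/eqP/cards1P; exists set0; apply/setP=> M.
  move/eqP: cardA; rewrite cards_eq0 => /eqP->; rewrite !inE partition_set0.
  by case: eqP => [->|]; rewrite ?sub0set ?andbF.
have /card_gt0P[a aA] : (0 < #|A|)%N by rewrite cardA.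
rewrite doubleS subn1 [_.+2.-1]/= odd_double_factS mulnC.
transitivity (\sum_(M in pairings A) \sum_(b in A :\ a) ([set a; b] \in M))%N.
  rewrite -sum1_card; apply: eq_bigr => M;
    rewrite inE => /andP[/subsetP MK partM].
  have aM : a \in cover M by rewrite (cover_partition partM).
  have bM := pblock_mem aM; have := MK _ bM; rewrite inE.
  have := aM; rewrite -mem_pblock => ab.
  rewrite (cardsD1 a) ab eqSS => /cards1P[b bE].
  have pE : pblock M a = [set a; b] by rewrite -(setD1K ab) bE.
  have /setD1P[ba bP] : b \in pblock M a :\ a by rewrite bE set11.
  have bA : b \in A :\ a by rewrite !inE ba (subsetP (partitionS partM bM)).
  rewrite (bigD1 b) //= -pE bM big1 //= => c /andP[/setD1P[ca _] cb].
  apply/eqP; rewrite eqb0; apply: contra cb => acM.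
  have := def_pblock (partition_trivIset partM) acM (set21 a c);
    rewrite pE => /setP/(_ c).
  by rewrite !inE eqxx orbT (negPf ca).
rewrite exchange_big /= -[X in (X * _)%N](_ : #|A :\ a| = _); last first.
  by move: cardA; rewrite (cardsD1 a) aA doubleS => -[].
rewrite -sum_nat_const; apply: eq_bigr => b /setD1P[ba bA].
set e := [set a; b]; have e0 : e != set0 by apply/set0Pn; exists a;
  rewrite set21.
have eA : e \subset A by rewrite subUset !sub1set aA.
have e2 : #|e| = 2 by rewrite cards2 eq_sym ba.
have cardAe : #|A :\: e| = m.*2 by rewrite cardsDS // cardA e2 doubleS subn2.
rewrite -(IHm _ cardAe) -big_mkcondr /= sum1dep_card.
rewrite -(card_in_imset (f := fun M => e |: M) (D := pairings (A :\: e))).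
  apply: eq_card => M; rewrite !inE; apply/andP/imsetP.
    case=> /andP[MK partM] eM; exists (M :\ e); last by rewrite setD1K.
    rewrite inE (subset_trans _ MK) ?subsetDl //=.
    by rewrite -partition_with_block // setD1K // partM !inE eqxx.
  case=> N; rewrite inE -partition_with_block // => /and3P[NK partN eN] ->.
  by rewrite partN subUset NK sub1set setU11 inE e2 eqxx.
move=> M N;
  rewrite !inE -!partition_with_block // => /and3P[_ _ eM] /and3P[_ _ eN].
by move/(congr1 (fun M => M :\ e)); rewrite !setU1K.
Qed.

Lemma card_perfect_matchings : ~~ odd #|V| ->
  #|perfect_matchings (complete_graph V)| = odd_double_fact (#|V| - 1).
Proof.
move=> evenV;
  have eqV : #|V| = (#|V|./2).*2 by rewrite -[LHS]odd_double_half (negPf evenV).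
by rewrite [in RHS]eqV -(card_pairings (A := setT)) ?cardsT.
Qed.

End CountMatchings.

(** * Regular graphs and pairs of adjacent edges *)

Section RegularGraph.

Variables (d : Order.disp_t) (V : finOrderType d) (E : {set {set V}}) (k : nat).
Hypothesis simpleE : simple_graph E.
Hypothesis regE : regular_graph E k.
Implicit Types (e f : {set V}) (u v w : V).

Definition neighbours v : {set V} := [set w | [set v; w] \in E].

Lemma neighbour_neq v w : w \in neighbours v -> w != v.
Proof.
rewrite inE => vw; apply: contraTneq vw => ->; apply/negP=> /simpleE.
by rewrite cards2 eqxx.
Qed.

Lemma edge_neighbour e v : e \in E -> v \in e ->
  exists2 w, w \in neighbours v & e = [set v; w].
Proof.
move=> eE ve; have /eqP/cards2P[x [y [xy exy]]] := simpleE eE.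
move: ve; rewrite exy !inE => /orP[]/eqP->; [exists y|exists x];
  rewrite ?inE -?exy //.
  by rewrite setUC -exy.
by rewrite exy setUC.
Qed.

Lemma neighbour_edge_inj v : {in neighbours v &, injective (fun w => [set v;
  w])}.
Proof.
move=> a b av bv /= /setP/(_ a);
  rewrite !inE eqxx orbT (negPf (neighbour_neq av)) /=.
by move/esym/eqP.
Qed.

Lemma neighbour_edges v :
  [set [set v; w] | w in neighbours v] = [set e in E | v \in e].
Proof.
apply/setP=> e; rewrite inE; apply/imsetP/andP=> [[w wv ->]|[eE ve]].
  by move: wv; rewrite inE set21.
by have [w wv ->] := edge_neighbour eE ve; exists w.
Qed.

Lemma card_neighbours v : #|neighbours v| = k.
Proof.
by rewrite -(card_in_imset (@neighbour_edge_inj v)) neighbour_edges regE.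
Qed.

Lemma handshake : (#|E| * 2 = #|V| * k)%N.
Proof.
rewrite -sum_nat_const -[RHS]sum_nat_const.
transitivity (\sum_(e in E) \sum_v (v \in e))%N.
  by apply: eq_bigr => e eE; rewrite -big_mkcond /= sum1_card simpleE.
rewrite exchange_big /=; apply: eq_bigr => v _; rewrite -big_mkcondr /=.
by rewrite sum1dep_card regE.
Qed.

(** The ordered pairs in [A] split into the diagonal and two equal halves. *)
Lemma sum_ltn_pairs (A : {set V}) :
  ((\sum_(a in A) \sum_(b in A | (a < b)%O) 1) * 2 + #|A| = #|A| * #|A|)%N.
Proof.
under eq_bigr do rewrite big_mkcondr /=.
rewrite -[X in _ = (X * _)%N]sum1_card [RHS]big_distrl /= muln2 -addnn.
rewrite [X in (_ + X + _)%N]exchange_big -sum1_card -!big_split /=.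
apply: eq_bigr => a aA; rewrite mul1n -big_split [RHS](bigD1 a) //=.
rewrite [in LHS](bigD1 a) //= ltxx addn0 add0n addnC; congr (_ + _)%N.
by apply: eq_bigr => b /andP[_ /lt_total/orP[]lt]; rewrite lt (lt_gtF lt).
Qed.

(** The factors of the graph polynomial of the line graph: adjacent edges, ordered by their ends
    other than the common vertex [t.1]. *)
Definition star_pairs : seq ({set V} * {set V}) :=
  [seq ([set t.1; t.2.1], [set t.1; t.2.2]) | t <- enum
    [pred t : V * (V * V) | [&& t.2.1 \in neighbours t.1,
                               t.2.2 \in neighbours t.1 & (t.2.1 < t.2.2)%O]]].

Lemma big_star_pairs (R : Type) (idx : R) (op : Monoid.com_law idx)
    (H : {set V} * {set V} -> R) :
  \big[op/idx]_(p <- star_pairs) H p =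
  \big[op/idx]_v \big[op/idx]_(a in neighbours v)
    \big[op/idx]_(b in neighbours v | (a < b)%O) H ([set v; a], [set v; b]).
Proof.
rewrite big_map big_enum /=.
under [RHS]eq_bigr do rewrite pair_big_dep.
by rewrite pair_big_dep.
Qed.

(** There are [k (k - 1) / 2] pairs at each vertex, so this follows from the handshake identity,
    doubled to avoid division. It is the degree of the monomial with exponent [k.-1] on every
    edge. *)
Lemma size_star_pairs : size star_pairs = (#|E| * k.-1)%N.
Proof.
have eq2 : (size star_pairs * 2 + #|E| * 2 = #|E| * 2 * k)%N.
  rewrite handshake -sum1_size big_star_pairs -!sum_nat_const !big_distrl -big_split /=.
  by apply: eq_bigr => v _; rewrite -(card_neighbours v) sum_ltn_pairs.
case: k eq2 => [|k'] /=; rewrite ?muln0.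
  by move/eqP; rewrite addn_eq0 !muln_eq0 /= !orbF => /andP[/eqP].
move=> eq2; apply/eqP; rewrite -(eqn_pmul2r (isT : 0 < 2)%N) mulnAC.
by rewrite -(eqn_add2r (#|E| * 2)) eq2 mulnS addnC.
Qed.

Lemma star_pairs_within : all (pairs_within E) star_pairs.
Proof.
apply/allP=> _ /mapP[t + ->]; rewrite mem_enum inE => /and3P[].
by rewrite /pairs_within /= !inE => -> ->.
Qed.

Lemma adjacent_star_pairs e f : e \in E -> f \in E -> e != f ->
  ~~ [disjoint e & f] -> ((e, f) \in star_pairs) || ((f, e) \in star_pairs).
Proof.
move=> eE fE ef /pred0Pn[v /andP[/= ve vf]].
have [a av ee] := edge_neighbour eE ve; have [b bv ff] := edge_neighbour fE vf.
have ab : a != b by apply: contraNneq ef => ab; rewrite ee ff ab.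
have [lt|lt] := orP (lt_total ab); apply/orP; [left|right]; apply/mapP.
  by exists (v, (a, b)); rewrite ?mem_enum ?inE /= -?ee -?ff ?eE ?fE.
by exists (v, (b, a)); rewrite ?mem_enum ?inE /= -?ee -?ff ?eE ?fE.
Qed.

End RegularGraph.

(** * Coefficient extraction by roots of unity *)

Section PowerSum.

Variables (R : numFieldType) (k : nat) (z : R).
Hypothesis prim_z : k.-primitive_root z.

(** The sum is geometric with ratio [z ^+ j.+1], which is 1 only if [k] divides [j.+1]. *)
Lemma prim_power_sum j : (j < k)%N ->
  \sum_(i < k) z ^+ i * (z ^+ i) ^+ j = if j == k.-1 then k%:R else 0.
Proof.
move=> ltjk; have k0 : (0 < k)%N by apply: leq_ltn_trans ltjk.
have powE (i : 'I_k) : z ^+ i * (z ^+ i) ^+ j = (z ^+ j.+1) ^+ i.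
  by rewrite -exprS -!exprM mulnC.
rewrite (eq_bigr _ (fun i _ => powE i)); case: eqP => [->|/eqP nej].
  rewrite prednK // (prim_expr_order prim_z); under eq_bigr do rewrite expr1n.
  by rewrite sumr_const card_ord.
have ltj1 : (j.+1 < k)%N by rewrite ltn_neqAle ltjk andbT -[X in _ != X](prednK k0) eqSS.
have z1 : z ^+ j.+1 - 1 != 0.
  rewrite subr_eq0 -[1](expr0 z) (eq_prim_root_expr prim_z) eqn_mod_dvd // subn0.
  by rewrite gtnNdvd.
apply/eqP; rewrite -(inj_eq (mulfI z1)) mulr0 -subrX1 exprAC.
by rewrite (prim_expr_order prim_z) expr1n subrr.
Qed.

(** Roots of unity see exponents only modulo [k]. The total degree settles the rest: unless all
    exponents are [k.-1], one of them is smaller and its factor vanishes. *)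
Lemma prod_power_sum (T : finType) (A : {set T}) (m : T -> nat) :
    (0 < k)%N -> (\sum_(x in A) m x)%N = (#|A| * k.-1)%N ->
  \prod_(x in A) \sum_(i < k) z ^+ i * (z ^+ i) ^+ m x =
  k%:R ^+ #|A| * [forall (x | x \in A), m x == k.-1]%:R.
Proof.
move=> k0 sum_m;
  have [/forall_inP all_eq|] := boolP [forall (x | x \in A), m x == k.-1].
  rewrite mulr1 -prodr_const; apply: eq_bigr => x xA.
  by rewrite (eqP (all_eq x xA)) prim_power_sum ?eqxx // ltn_predL.
move=> not_eq; rewrite mulr0.
have [/exists_inP[x xA lt]|] := boolP [exists (x | x \in A), m x < k.-1]%N.
  rewrite (bigD1 x) //= prim_power_sum ?(ltn_eqF lt) ?mul0r //.
  exact: leq_trans lt (leq_pred k).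
rewrite negb_exists_in => /forall_inP ge; case/negP: not_eq.
have le x : x \in A -> (k.-1 <= m x ?= iff (m x == k.-1))%N.
  by move=> xA; split; rewrite 1?eq_sym // leqNgt ge.
by have [_ <-] := leqif_sum le; rewrite sum_m sum_nat_const.
Qed.

End PowerSum.

(** * Proper edge colorings and factorizations *)

Section Colorings.

Variables (d : Order.disp_t) (V : finOrderType d) (E : {set {set V}}) (k : nat).
Hypothesis simpleE : simple_graph E.
Hypothesis regE : regular_graph E k.+1.
Hypothesis V0 : (0 < #|V|)%N.
Implicit Types (e f : {set V}) (v : V) (F : {set {set {set V}}}).

Local Notation coloring := {ffun {set V} -> 'I_k.+1}.
Implicit Types c : coloring.

Definition proper_on c : bool :=
  [forall (e | e \in E), forall (f | f \in E),
     (e != f) && ~~ [disjoint e & f] ==> (c e != c f)].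

(* A coloring is a total function, normalized to ord0 outside E.              *)
Definition off_edges c : bool := [forall (e | e \notin E), c e == ord0].

Definition color_class c i : {set {set V}} := [set e in E | c e == i].

Definition color_classes c : {set {set {set V}}} := [set color_class c i | i : 'I_k.+1].

Lemma proper_onP c : reflect
  (forall e f, e \in E -> f \in E -> e != f -> ~~ [disjoint e & f] -> c e != c f)
  (proper_on c).
Proof.
apply: (iffP forall_inP) => [h e f eE fE ef ndis|h e eE].
  by have /forall_inP/(_ f fE) := h e eE; rewrite ef ndis.
by apply/forall_inP=> f fE; apply/implyP=> /andP[]; apply: h.
Qed.

Lemma color_class_disjoint c i j : i != j -> [disjoint color_class c i & color_class c j].
Proof.
move=> ij; rewrite -setI_eq0; apply/eqP/setP=> e; rewrite !inE.
by apply/negP=> /andP[/andP[_ /eqP->] /andP[_]]; apply/negP.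
Qed.

Lemma bigcup_color_class c : \bigcup_i color_class c i = E.
Proof.
apply/setP=> e; apply/bigcupP/idP=> [[i _]|eE]; first by rewrite inE => /andP[].
by exists (c e); rewrite // inE eE eqxx.
Qed.

(** The [k.+1] edges at a vertex have distinct colors, so every color occurs there. *)
Lemma color_class_perfect c i : proper_on c -> color_class c i \in perfect_matchings E.
Proof.
move/proper_onP=> prop; rewrite inE; apply/andP; split.
  by apply/subsetP=> e; rewrite inE => /andP[].
apply/and3P; split; last first.
- by rewrite inE; apply/negP=> /andP[/simpleE]; rewrite cards0.
- apply/trivIsetP=> e f; rewrite !inE => /andP[eE /eqP ei] /andP[fE /eqP fi] ef.
  by apply: contraT => /(prop e f eE fE ef); rewrite ei fi eqxx.
- apply/eqP/setP=> v; rewrite inE; apply/bigcupP.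
  set S := [set e in E | v \in e].
  have injS : {in S &, injective c}.
    move=> e f; rewrite !inE => /andP[eE ve] /andP[fE vf] cef.
    apply/eqP; apply: contraT => ef; have := prop e f eE fE ef;
      rewrite cef eqxx.
    by apply; apply/pred0Pn; exists v; rewrite /= ve.
  have : i \in c @: S.
    suff -> : c @: S = setT by rewrite inE.
    apply/eqP; rewrite eqEcard subsetT cardsT card_ord card_in_imset //.
    by rewrite /S regE leqnn.
  case/imsetP=> e; rewrite inE => /andP[eE ve] ->; exists e => //.
  by rewrite inE eE eqxx.
Qed.

Lemma perfect_complete M : M \in perfect_matchings E ->
  M \in perfect_matchings (complete_graph V).
Proof.
rewrite !inE => /andP[/subsetP ME ->]; rewrite andbT.
by apply/subsetP=> e /ME/simpleE; rewrite inE => ->.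
Qed.

Lemma color_class_inj c : proper_on c -> injective (color_class c).
Proof.
move=> prop i j eq_ij; apply/eqP; apply: contraT => /(color_class_disjoint c).
rewrite eq_ij -setI_eq0 setIid => /eqP M0.
have := card_matching (perfect_complete (color_class_perfect j prop)).
by rewrite M0 cards0 mul0n => cardV; have := V0; rewrite -cardV.
Qed.

Lemma color_classes_factorization c : proper_on c -> color_classes c \in one_factorizations E.
Proof.
move=> prop; rewrite inE; apply/andP; split; last first.
  by apply/subsetP=> _ /imsetP[i _ ->]; apply: color_class_perfect.
rewrite -(bigcup_color_class c).
have [|i _|] := @indexed_partition _ _ predT (color_class c).
- by move=> i j _ _ ji; rewrite color_class_disjoint // eq_sym.
- apply: contraNneq (lt0n_neq0 V0) => M0;
  rewrite -(card_matching (perfect_complete (color_class_perfect i prop))).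
  by rewrite M0 cards0.
- by rewrite /cover big_imset //= => i j _ _; apply: color_class_inj.
Qed.

(** Such a coloring amounts to an injective indexing of the [k.+1] matchings of [F] by the
    colors. *)
Lemma card_colorings_with_classes F : F \in one_factorizations E ->
  #|[set c | [&& off_edges c, proper_on c & color_classes c == F]]| = k.+1`!.
Proof.
move=> FE; have cardF : #|F| = k.+1.
  by have /card_gt0P[v _] := V0; apply: card_one_factorization v regE FE.
have: F \in one_factorizations E by [].
rewrite inE => /andP[partF /subsetP FM].
pose h c := [ffun i => color_class c i].
transitivity #|[set f : {ffun 'I_k.+1 -> {set {set V}}} in ffun_on [in F] | injectiveb f]|;
  last by rewrite card_inj_ffuns_on card_ord cardF ffactnn.
rewrite -(card_in_imset (f := h)).
  apply: eq_card => f; rewrite [RHS]inE; apply/imsetP/andP.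
    case=> c; rewrite inE => /and3P[_ prop /eqP cF] ->; split.
      by apply/ffun_onP=> i; rewrite ffunE -cF imset_f.
    by apply/injectiveP=> i j; rewrite !ffunE; apply: color_class_inj.
  case=> /ffun_onP fF' /injectiveP injf; have fF i : f i \in F by apply: fF'.
  have imf : [set f i | i : 'I_k.+1] = F.
    apply/eqP; rewrite eqEcard card_imset // card_ord cardF leqnn andbT.
    by apply/subsetP=> _ /imsetP[i _ ->]; apply: fF.
  have trivF := partition_trivIset partF.
  (* An edge gets the index of its matching; outside [E] the default [ord0] is the value that
     [off_edges] requires. *)
  pose c : coloring := [ffun e => odflt ord0 [pick i | e \in f i]].
  have f_unique e i j : e \in f i -> e \in f j -> i = j.
    move=> ei ej; apply: injf.
    by rewrite -(def_pblock trivF (fF i) ei) (def_pblock trivF (fF j) ej).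
  have cE e i : e \in f i -> c e = i.
    move=> ei; rewrite ffunE; case: pickP => [j ej|/(_ i)]; last by rewrite ei.
    by rewrite (f_unique e j i ej ei).
  have c_class i : color_class c i = f i.
    apply/setP=> e; rewrite inE; apply/andP/idP=> [[eE /eqP <-]|ei].
      move: eE;
        rewrite -(cover_partition partF) -imf cover_imset => /bigcupP[j _ ej].
      by rewrite (cE _ _ ej).
    split; last by rewrite (cE _ _ ei).
    by apply: (subsetP (partitionS partF (fF i))).
  exists c; last by apply/ffunP=> i; rewrite ffunE c_class.
  rewrite inE; apply/andP; split.
    apply/forall_inP=> e eE; rewrite ffunE; case: pickP => [i ei|_ //].
    by case/negP: eE; apply: (subsetP (partitionS partF (fF i))).
  apply/andP; split; last by rewrite /color_classes (eq_imset _ c_class) imf.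
  apply/proper_onP=> e e' eE eE' ee'; apply: contra => /eqP cee'.
  have: e \in color_class c (c e) by rewrite inE eE eqxx.
  have: e' \in color_class c (c e) by rewrite inE eE' cee' eqxx.
  rewrite c_class => e'i ei; have := FM _ (fF (c e));
    rewrite inE => /andP[_ partM].
  by have /trivIsetP := partition_trivIset partM; apply.
move=> c1 c2;
  rewrite !inE => /andP[/forall_inP off1 _] /andP[/forall_inP off2 _].
move/ffunP=> eqh; apply/ffunP=> e; have [eE|eE] := boolP (e \in E).
  have := eqh (c1 e); rewrite !ffunE => /setP/(_ e).
  by rewrite !inE eE eqxx /= => /esym/eqP.
by rewrite (eqP (off1 e eE)) (eqP (off2 e eE)).
Qed.

End Colorings.

(** * The coefficient as a multiple of the signed count *)

Section ColoringFormula.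

Variables (d : Order.disp_t) (V : finOrderType d) (E : {set {set V}}) (k : nat).
Hypothesis simpleE : simple_graph E.
Hypothesis regE : regular_graph E k.+1.
Hypothesis V0 : (0 < #|V|)%N.
Implicit Types c : {ffun {set V} -> 'I_k.+1}.

Local Notation sgn b := ((-1) ^+ nat_of_bool b : int).

(** The factor in [sign_ordered_factorization] that all factorizations of [E] share. *)
Definition order_sign : int :=
  (-1) ^+ cr E * \prod_(i < k.+1) \prod_(j < k.+1 | (i < j)%N)
    \prod_(x : V) \prod_(y : V) sgn (x < y)%O.

Lemma order_sign_sqr : order_sign * order_sign = 1.
Proof.
rewrite mulrACA -signr_odd sgn_sqr mul1r -big_split big1 //= => i _.
rewrite -big_split big1 //= => j _; rewrite -big_split big1 //= => x _.
by rewrite -big_split big1 //= => y _; rewrite sgn_sqr.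
Qed.

Lemma star_product_improper (R : comNzRingType) (x : 'I_k.+1 -> R) c :
  ~~ proper_on E c -> \prod_(p <- star_pairs E) (x (c p.1) - x (c p.2)) = 0.
Proof.
rewrite negb_forall_in => /exists_inP[e eE];
  rewrite negb_forall_in => /exists_inP[f fE].
rewrite negb_imply negbK -andbA => /and3P[ef ndis /eqP cef].
have [in_s|in_s] := orP (adjacent_star_pairs simpleE eE fE ef ndis).
  by rewrite (big_rem _ in_s) /= cef subrr mul0r.
by rewrite (big_rem _ in_s) /= cef subrr mul0r.
Qed.

(** Ordering the factors at [v] by color rather than by neighbour gives a Vandermonde product, the
    same for all colorings, times the signs of the comparisons of mates. These multiply to
    [order_sign] times the sign of the factorization. *)
Lemma star_product_proper (R : comNzRingType) (x : 'I_k.+1 -> R) c :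
    proper_on E c ->
  \prod_(p <- star_pairs E) (x (c p.1) - x (c p.2)) =
  (\prod_(v : V) \prod_(i < k.+1) \prod_(j < k.+1 | (i < j)%N) (x j - x i)) *
    (order_sign * factorization_sign (color_classes E c))%:~R.
Proof.
move=> prop; pose g := color_class E c.
have pm_g i : g i \in perfect_matchings (complete_graph V).
  exact/(perfect_complete simpleE)/color_class_perfect.
have dis_g i j : i != j -> [disjoint g i & g j] by apply: color_class_disjoint.
have cov_g : \bigcup_i g i = E by apply: bigcup_color_class.
have cE v i : c [set v; mate (g i) v] = i.
  by have := mate_edge (pm_g i) v; rewrite inE => /andP[_ /eqP].
have N_eq v : neighbours E v = [set mate (g i) v | i : 'I_k.+1].
  rewrite -mate_color_image // cov_g; apply/setP=> w; rewrite [RHS]inE.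
  have [wv|] := boolP (w \in neighbours E v).
    by rewrite (neighbour_neq simpleE wv); move: wv; rewrite inE => ->.
  by rewrite inE => /negPf ->; rewrite andbF.
have -> : \prod_(p <- star_pairs E) (x (c p.1) - x (c p.2)) =
    \prod_(v : V) \prod_(i < k.+1) \prod_(j < k.+1 | (i < j)%N)
      ((x j - x i) * (sgn (mate (g i) v < mate (g j) v)%O)%:~R).
  rewrite big_star_pairs; apply: eq_bigr => v _.
  (* The extra sign makes [H] symmetric, as [prod_ordered_pairs] requires. *)
  pose H (a b : V) := (x (c [set v; b]) - x (c [set v;
    a])) * (sgn (a < b)%O)%:~R.
  transitivity (\prod_(a in neighbours E v) \prod_(b in neighbours E v | (a < b)%O) H a b).
    apply: eq_bigr => a _; apply: eq_bigr => b /andP[_ ab].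
    by rewrite /H ab expr1 mulrN1 opprB.
  rewrite (prod_ordered_pairs (mate_color_inj pm_g dis_g (v := v)) (N_eq v)) => [|a b ab].
    by apply: eq_bigr => i _; apply: eq_bigr => j _; rewrite /H !cE.
  rewrite /H -opprB mulNr -mulrN; congr (_ * _).
  by case/orP: (lt_total ab) => lt;
    rewrite lt (lt_gtF lt) ?expr1 ?expr0 ?rmorphN ?opprK.
under eq_bigr do under eq_bigr do rewrite big_split.
under eq_bigr do rewrite big_split.
rewrite big_split; congr (_ * _).
have -> : factorization_sign (color_classes E c) = \prod_i matching_sign (g i).
  rewrite /factorization_sign big_imset //= => i j _ _.
  exact: (color_class_inj simpleE regE V0).
rewrite (sign_ordered_factorization pm_g dis_g) cov_g.
under [in X in _ = (_ * X)%:~R]eq_bigr do rewrite big_split.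
rewrite big_split [X in order_sign * X]mulrA -/order_sign mulrA order_sign_sqr mul1r.
rewrite exchange_big rmorph_prod; apply: eq_bigr => i _ /=.
rewrite exchange_big rmorph_prod; apply: eq_bigr => j _ /=.
by rewrite rmorph_prod.
Qed.

Variables (R : numFieldType) (z : R).
Hypothesis prim_z : k.+1.-primitive_root z.

(** The contribution of any proper coloring, up to the sign of its factorization; each color is used
    on [#|V|./2] edges. *)
Definition coloring_weight : R :=
  \prod_(i < k.+1) (z ^+ i) ^+ #|V|./2 *
  (\prod_(v : V) \prod_(i < k.+1) \prod_(j < k.+1 | (i < j)%N) (z ^+ j - z ^+ i)) *
  order_sign%:~R.

Lemma prim_root_neq0 : z != 0.
Proof.
by apply: contra_eq_neq (prim_expr_order prim_z) => ->;
  rewrite expr0n eq_sym oner_eq0.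
Qed.

Lemma coloring_weight_neq0 : coloring_weight != 0.
Proof.
rewrite !mulf_neq0 //.
- by apply/prodf_neq0=> i _; rewrite !expf_neq0 // prim_root_neq0.
- apply/prodf_neq0=> v _; apply/prodf_neq0=> i _; apply/prodf_neq0=> j ij.
  rewrite subr_eq0 (eq_prim_root_expr prim_z) !modn_small //.
  by rewrite gtn_eqF.
- rewrite intr_eq0; apply/eqP=> s0; have := order_sign_sqr.
  by rewrite s0 mul0r => /esym/eqP; rewrite oner_eq0.
Qed.

Lemma prod_color_weight c : proper_on E c ->
  \prod_(e in E) z ^+ c e = \prod_(i < k.+1) (z ^+ i) ^+ #|V|./2.
Proof.
move=> prop; rewrite -{1}(bigcup_color_class E c) partition_disjoint_bigcup;
  last first.
  by move=> i j; apply: color_class_disjoint.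
apply: eq_bigr => i _; have pmi := color_class_perfect simpleE regE i prop.
rewrite -(card_matching (perfect_complete simpleE pmi)) muln2 doubleK -prodr_const.
by apply: eq_bigr => e; rewrite inE => /andP[_ /eqP->].
Qed.

(** The filter by roots of unity expands the coefficient into values of the product at the points
    [z ^+ c e], one for each coloring [c]. Improper colorings give 0, and each factorization comes
    from (k+1)! proper ones. *)
Lemma diffcoef_star_pairs :
  k.+1%:R ^+ #|E| * diffcoef R (star_pairs E) E (fun=> k) =
  coloring_weight * (k.+1`!%:R * (signed_count E)%:~R).
Proof.
rewrite /diffcoef -diffvalZ.
transitivity (diffval (star_pairs E) (fun m =>
    \prod_(e in E) \sum_(i < k.+1) z ^+ i * (z ^+ i) ^+ m e)).
  apply: (eq_diffval (star_pairs_within E)) => m _.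
  rewrite (size_star_pairs simpleE regE) => sum_m.
  by rewrite (prod_power_sum prim_z (ltn0Sn k) sum_m).
transitivity (diffval (star_pairs E) (fun m =>
  \sum_(c : {ffun {set V} -> 'I_k.+1} | off_edges E c)
    (\prod_(e in E) z ^+ c e) * \prod_(e in E) (z ^+ c e) ^+ m e)).
  (* Distributing the product over the sums yields the functions equal to [ord0] outside [E]. *)
  apply: eq_diffval_ext => m; rewrite (big_distr_big ord0).
  apply: eq_big => [c|c _]; last by rewrite big_split.
  apply/pffun_onP/forall_inP=> [[/subsetP sup _] e eE|off].
    by apply: contraT => /sup; rewrite (negPf eE).
  split; last by move=> i _.
  by apply/subsetP=> e; rewrite inE; apply: contraNT => /off.
rewrite diffval_sum.
transitivity (\sum_(c : {ffun {set V} -> 'I_k.+1} | off_edges E c && proper_on E c)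
    coloring_weight * (factorization_sign (color_classes E c))%:~R).
  rewrite [RHS]big_mkcondr; apply: eq_bigr => c _.
  rewrite diffvalZ (diffval_eval (fun e => z ^+ c e)) ?star_pairs_within //.
  case: ifPn => [prop|]; last first.
    by move/(star_product_improper (fun i => z ^+ i))->; rewrite mulr0.
  rewrite (star_product_proper (fun i => z ^+ i) prop) prod_color_weight //.
  by rewrite rmorphM /coloring_weight !mulrA.
rewrite -big_distrr /=; congr (_ * _).
rewrite (partition_big (fun c : {ffun {set V} -> 'I_k.+1} =>
  color_classes E c) (mem (one_factorizations E))) /=; last first.
  by move=> c /andP[_]; apply: color_classes_factorization.
rewrite /signed_count rmorph_sum big_distrr; apply: eq_bigr => F FE.
rewrite -(card_colorings_with_classes simpleE regE V0 FE) /= mulr_natl -sumr_const.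
apply: eq_big => [c|c /andP[_ /eqP->] //].
by rewrite inE andbA.
Qed.

Lemma diffcoef_star_pairs_neq0 :
  signed_count E != 0 -> diffcoef R (star_pairs E) E (fun=> k) != 0.
Proof.
move=> S0; have: k.+1%:R ^+ #|E| * diffcoef R (star_pairs E) E (fun=> k) != 0.
  rewrite diffcoef_star_pairs; apply: mulf_neq0 coloring_weight_neq0 _.
  by rewrite mulf_neq0 ?intr_eq0 // pnatr_eq0 -lt0n fact_gt0.
by apply: contraNneq => ->; rewrite mulr0.
Qed.

End ColoringFormula.

(** * From nonzero signed counts to coloring indices *)

Lemma regular_painter_wins (d : Order.disp_t) (V : finOrderType d)
    (E : {set {set V}}) k :
    (0 < #|V|)%N -> simple_graph E -> regular_graph E k -> signed_count E != 0 ->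
  painter_wins E (fun=> k).
Proof.
case: k => [|k] V0 simpleE regE S0.
  (* Degree 0 leaves no edge to color. *)
  suff -> : E = set0 by apply: PainterDone.
  apply/eqP; rewrite -cards_eq0 -(eqn_pmul2r (isT : 0 < 2)%N).
  by rewrite (handshake simpleE regE) muln0.
have [z prim_z] := C_prim_root_exists (ltn0Sn k).
have nz := diffcoef_star_pairs_neq0 simpleE regE V0 prim_z S0.
(* Every exponent is [k], one below the [k.+1] tokens. *)
apply: (painter_wins_diffcoef (s := star_pairs E) (d := fun=> k)) => //.
  by move=> e f eE fE; apply: adjacent_star_pairs.
by have /all_filterP-> := star_pairs_within E; apply: nz.
Qed.

Theorem proposition6p1 :
  (forall (d : Order.disp_t) (V : finOrderType d) (E : {set {set V}})
      (k : nat),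
    (0 < #|V|)%N -> simple_graph E -> regular_graph E k -> one_factorable E ->
    \sum_(M in perfect_matchings E) matching_sign M * signed_count (E :\: M)
      = k%:R * signed_count E)
  /\
  (forall n : nat, (4 <= n)%N -> ~~ odd n ->
    [/\ forall I : {set {set 'I_n}},
          I \in perfect_matchings (complete_graph 'I_n) ->
          (signed_count (complete_graph 'I_n :\: I))%:~R
            = (matching_sign I)%:~R
              * ((n - 1)%N%:R * (signed_count_complete n)%:~R
                 / (odd_double_fact (n - 1)%N)%:R) :> rat
          /\
          (matching_sign I)%:~R
              * ((n - 1)%N%:R * (signed_count_complete n)%:~R
                 / (odd_double_fact (n - 1)%N)%:R)
            = (matching_sign I)%:~R
              * ((signed_count_complete n)%:~R
                 / (odd_double_fact (n - 3)%N)%:R) :> rat,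
        ((odd_double_fact (n - 3)%N)%:Z %| signed_count_complete n)%Z
      & signed_count_complete n != 0 ->
        forall I : {set {set 'I_n}},
          I \in perfect_matchings (complete_graph 'I_n) ->
          is_paintability_index (complete_graph 'I_n :\: I) (n - 2)%N
          /\ is_list_chromatic_index (complete_graph 'I_n :\: I) (n - 2)%N]).

Proof.
split=> [d V E k V0 _ reg _|n n4 n_even];
  first exact: sum_signed_count_deletion.
set K := complete_graph 'I_n; set D := odd_double_fact (n - 3).
have cardV : #|'I_n| = n := card_ord n.
have V0 : (0 < #|'I_n|)%N by rewrite cardV; apply: leq_trans n4.
have V_even : ~~ odd #|'I_n| by rewrite cardV.
have simpleK : simple_graph K by move=> e; rewrite inE => /eqP.
have regK : regular_graph K (n - 1).
  move=> v; rewrite -[RHS](_ : #|[set~ v]| = _); last first.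
    by rewrite cardsC1 cardV subn1.
  rewrite -(card_in_imset (f := fun w => [set v; w])); last first.
    move=> a b; rewrite !inE => av bv /setP/(_ a).
    by rewrite !inE eqxx orbT (negPf av) /= => /esym/eqP.
  apply: eq_card => e; rewrite !inE; apply/andP/imsetP=> [[e2 ve]|[w]].
    have [x xe] : exists x, e :\ v = [set x].
      by apply/cards1P; move: e2; rewrite (cardsD1 v) ve eqSS.
    exists x; last by rewrite -xe setD1K.
    by have := set11 x; rewrite -xe !inE => /andP[].
  by rewrite !inE => wv ->; rewrite cards2 [v == w]eq_sym wv set21.
(* With [n] in this form the truncated subtractions compute. *)
have [m n_eq] : exists m, n = m.*2.+4.
  exists (n - 4)./2;
    rewrite -[LHS](subnK n4) -[(n - 4)%N in LHS]odd_double_half.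
  by rewrite oddB // (negPf n_even) addn4.
have D1 : odd_double_fact (n - 1) = (D * (n - 1))%N.
  by rewrite /D n_eq !subSS !subn0 -doubleS odd_double_factS doubleS subn1.
have D_neq0 : D%:R != 0 :> rat.
  rewrite pnatr_eq0 /D n_eq !subSS subn0 -lt0n /odd_double_fact.
  by rewrite big_nat_cond; apply: prodn_cond_gt0 => i /andP[/andP[]].
have n1_neq0 : (n - 1)%N%:R != 0 :> rat by rewrite pnatr_eq0 n_eq.
have msqr I : matching_sign I * matching_sign I = 1 :> int.
  by rewrite /matching_sign -signr_odd -expr2 sqrr_sign.
(* All (n-1)!! terms of the deletion identity equal that of [I]; cancelling [n - 1] leaves the
   factor (n-3)!!. *)
have main I : I \in perfect_matchings K ->
    signed_count_complete n = D%:Z * (matching_sign I * signed_count (K :\: I)).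
  move=> pmI; have n1Z : ((n - 1)%N%:R : int) != 0 by rewrite pnatr_eq0 n_eq.
  apply: (mulfI n1Z); rewrite -[LHS](sum_signed_count_deletion V0 regK).
  under eq_bigr =>
    M pmM do rewrite (signed_count_deletion_eq V_even V0 pmM pmI).
  rewrite sumr_const card_perfect_matchings // cardV D1 -[LHS]mulr_natl (mulnC D) natrM.
  by rewrite -mulrA (natz D).
split=> [I pmI||S0 I pmI].
- have cancel x : (n - 1)%N%:R * x / (odd_double_fact (n - 1))%:R = x / D%:R :> rat.
    by rewrite D1 natrM [_ * x]mulrC -mulf_div divff // mulr1.
  rewrite cancel; split=> //.
  rewrite (main I pmI) !rmorphM /= [X in _ * X]mulrAC divff // mul1r mulrA.
  by rewrite -rmorphM msqr mul1r.
(* Divisibility needs one perfect matching, and their number (n-1)!! is positive. *)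
- have /card_gt0P[I pmI] : (0 < #|perfect_matchings K|)%N.
    rewrite card_perfect_matchings // cardV D1 muln_gt0.
    by rewrite lt0n -(pnatr_eq0 rat) D_neq0 lt0n -(pnatr_eq0 rat) n1_neq0.
  by rewrite (main I pmI) dvdz_mulr.
(* Deleting [I] removes exactly one edge at [v], its block in [I]. *)
have regKI : regular_graph (K :\: I) (n - 2).
  have [IK partI] := perfect_matchingP _ _ pmI.
  move=> v;
    have -> : [set e in K :\: I | v \in e] = [set e in K | v \in e] :\ pblock I v.
    by apply/setP=> e; rewrite !inE -mem_block //; case: (e \in I);
      case: (v \in e); rewrite ?andbF ?andbT.
  have bK : pblock I v \in [set e in K | v \in e].
    have /andP[bI vb] : (pblock I v \in I) && (v \in pblock I v) by rewrite mem_block.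
    by rewrite inE vb (subsetP IK).
  have := regK v;
    rewrite (cardsD1 (pblock I v)) bK add1n => /(congr1 predn) /= ->.
  by rewrite -subn1 -subnDA.
have [v _] := card_gt0P V0.
apply: (painter_wins_indices (v := v)) => //.
apply: (regular_painter_wins V0) => //.
  by move=> e /setDP[/simpleK].
apply: contra_neq S0 => S0; by rewrite (main I pmI) S0 !mulr0.
Qed.
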